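(* For every $n\in\mathbb{Z}$ let $k_n$ and $l_n$ be coprime integers greater than one. For every integer $m\ge 0$ let $G_{(m)}$ be the group with finite presentation $$G_{(m)}=\langle\, g_{-m},\dots,g_0,\dots,g_m \mid g_{-m}^{k_{-m+1}}=g_{-m+1}^{l_{-m+1}},\ \dots,\ g_{m-1}^{k_m}=g_m^{l_m}\,\rangle$$ (so the relations are $g_{i-1}^{k_i}=g_i^{l_i}$ for $-m+1\le i\le m$), and let $P_{(m)}$ be the positive cone of $G_{(m)}$ defined by $$P_{(m)}=\Big\langle \{g_{-m}\}\cup\{\,g_{-m}^{-k_{-m+1}+1}g_{-m+1}^{-k_{-m+2}+1}\cdots g_{i-1}^{-k_i+1}g_i \mid -m+1\le i\le m\,\}\Big\rangle^{+}.$$ Then the inductive limit $P_{(\infty)}=\varinjlim P_{(m)}$ of the inductive system $\{P_{(m)}\}_{m\ge 0}$ is the positive cone of a left ordering of the inductive limit $G_{(\infty)}=\varinjlim G_{(m)}$ of the inductive system $\{G_{(m)}\}_{m\ge 0}$, and this left ordering is approximated by its conjugate orderings. In particular, $P_{(\infty)}$ is not the positive cone of an isolated ordering of $G_{(\infty)}$.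
   Context: A left ordering of a group $G$ is a total order $<_G$ on $G$ with $a<_G b\Rightarrow ga<_G gb$ for all $a,b,g\in G$. Its positive cone is $P=\{g\in G: 1<_G g\}$. A subset $P\subset G$ is the positive cone of a left ordering iff $P\cdot P\subset P$ and $G=P\sqcup P^{-1}\sqcup\{1\}$; the ordering is then $g<_G h\iff g^{-1}h\in P$, and left orderings are identified with their positive cones. $\langle S\rangle^{+}$ denotes the subsemigroup generated by $S$. $\mathrm{LO}(G)$ is the set of all left orderings of $G$, with the topology having as sub-basis the sets $\{<'\in\mathrm{LO}(G): 1<'g\}$, $g\in G$ (equivalently, the subspace topology from $2^G$ on positive cones). An isolated ordering is an isolated point of $\mathrm{LO}(G)$. For $g\in G$ the conjugate ordering $<_g$ of $<_G$ is defined by $g_1<_g g_2\iff g_1g<_G g_2g$. A left ordering is approximated by its conjugate orderings if every neighbourhood of it in $\mathrm{LO}(G)$ contains a conjugate ordering of it that is different from it. The inductive system $\{G_{(m)}\}$ is given by the homomorphisms $G_{(m)}\to G_{(m+1)}$, $g_i\mapsto g_i$. These are injective ($G_{(m+1)}$ is obtained from $G_{(m)}$ by two successive amalgamated free products with infinite cyclic groups), so each $G_{(m)}$ is regarded as a subgroup of $G_{(m+1)}$, and $G_{(\infty)}=\bigcup_m G_{(m)}$. The maps of the system $\{P_{(m)}\}$ are the inclusions obtained by restriction, and $P_{(\infty)}=\bigcup_m P_{(m)}\subset G_{(\infty)}$. That $P_{(m)}$ is the positive cone of a left ordering of $G_{(m)}$ is a known theorem of Dehornoy. *)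

(* Defs.v *)
From HB Require Import structures.
From mathcomp Require Import all_boot all_order all_algebra.
From mathcomp Require Import all_classical topology.
From mathcomp Require Import zify.
Set Implicit Arguments.
Unset Strict Implicit.
Unset Printing Implicit Defensive.
Import Order.TTheory GRing.Theory Num.Theory.

Local Open Scope classical_set_scope.
Local Open Scope group_scope.

Record leftOrder (G : groupType) := LeftOrder {
  lo_lt : G -> G -> Prop;
  lo_irr : forall a, ~ lo_lt a a;
  lo_trans : forall a b c, lo_lt a b -> lo_lt b c -> lo_lt a c;
  lo_total : forall a b, a <> b -> lo_lt a b \/ lo_lt b a;
  lo_mul : forall g a b, lo_lt a b -> lo_lt (g * a) (g * b)
}.

HB.instance Definition _ (G : groupType) := gen_eqMixin (leftOrder G).
HB.instance Definition _ (G : groupType) := gen_choiceMixin (leftOrder G).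

Definition lo_subbase (G : groupType) : set (set (leftOrder G)) :=
  range (fun g : G => [set o : leftOrder G | lo_lt o 1 g]).

HB.instance Definition _ (G : groupType) :=
  @isSubBaseTopological.Build (leftOrder G) _ (@lo_subbase G) id.

Definition positive_cone (G : groupType) (o : leftOrder G) : set G :=
  [set g | lo_lt o 1 g].

Section ConjugateOrder.
Variables (G : groupType) (o : leftOrder G) (g : G).

Let lt a b := lo_lt o (a * g) (b * g).

Let lt_irr a : ~ lt a a. Proof. exact: lo_irr. Qed.

Let lt_trans a b c : lt a b -> lt b c -> lt a c. Proof. exact: lo_trans. Qed.

Let lt_total a b : a <> b -> lt a b \/ lt b a.
Proof. by move=> ab; apply: lo_total => /mulIg. Qed.

Let lt_mul h a b : lt a b -> lt (h * a) (h * b).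
Proof. by rewrite /lt -!mulgA; apply: lo_mul. Qed.

Definition conj_order : leftOrder G := LeftOrder lt_irr lt_trans lt_total lt_mul.

End ConjugateOrder.

Definition approximated_by_conjugates (G : groupType) (o : leftOrder G) :=
  forall U, nbhs o U -> exists g : G, U (conj_order o g) /\ conj_order o g <> o.

Definition isolated_order (G : groupType) (o : leftOrder G) :=
  isolated [set: leftOrder G] o.

Lemma leftOrder_ext (G : groupType) (o o' : leftOrder G) :
  positive_cone o = positive_cone o' -> o = o'.
Proof.
move=> oo'; have E : lo_lt o = lo_lt o'.
  apply/funext => a; apply/funext => b; apply/propext.
  have P (q : leftOrder G) : lo_lt q a b <-> positive_cone q (a^-1 * b).
    split; first by move/(lo_mul a^-1); rewrite mulVg.
    by move/(lo_mul a); rewrite mulg1 mulVKg.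
  by rewrite !P oo'.
case: o o' E {oo'} => lt h1 h2 h3 h4 [lt' h1' h2' h3' h4'] /= E.
by subst lt'; congr LeftOrder; apply: Prop_irrelevance.
Qed.

Definition subsemigroup (G : groupType) (A : set G) :=
  forall x y, A x -> A y -> A (x * y).

Definition semigroup_gen (G : groupType) (S : set G) : set G :=
  smallest (@subsemigroup G) S.

(* The letter (x, true) stands for the generator x, and (x, false) for its
   inverse. *)
Notation word X := (seq (X * bool)).

Section Presentation.
Variables (X : choiceType) (R : word X -> word X -> Prop).

Inductive word_eq : word X -> word X -> Prop :=
| word_eq_refl u : word_eq u u
| word_eq_sym u v : word_eq u v -> word_eq v u
| word_eq_trans u v w : word_eq u v -> word_eq v w -> word_eq u w
| word_eq_cat u u' v v' :
    word_eq u u' -> word_eq v v' -> word_eq (u ++ v) (u' ++ v')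
| word_eq_cancel x b : word_eq [:: (x, b); (x, ~~ b)] [::]
| word_eq_rel u v : R u v -> word_eq u v.

Definition word_eqb : rel (word X) := fun u v => `[< word_eq u v >].

Let eqb_refl : reflexive word_eqb.
Proof. by move=> u; apply/asboolP; apply: word_eq_refl. Qed.

Let eqb_sym : symmetric word_eqb.
Proof. by move=> u v; apply/asboolP/asboolP; apply: word_eq_sym. Qed.

Let eqb_trans : transitive word_eqb.
Proof.
by move=> u v w /asboolP vu /asboolP uw; apply/asboolP/(word_eq_trans vu).
Qed.

Canonical word_equiv := EquivRel word_eqb eqb_refl eqb_sym eqb_trans.

Definition presented := {eq_quot word_equiv}%qT.

HB.instance Definition _ := Choice.on presented.
HB.instance Definition _ := EqQuotient.on presented.

Definition pres_word (u : word X) : presented := (\pi_presented u)%qT.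

Definition pres_gen (x : X) : presented := pres_word [:: (x, true)].

Lemma pres_wordP u v : pres_word u = pres_word v <-> word_eq u v.
Proof. by split=> [/eqmodP/asboolP|uv] //; apply/eqmodP/asboolP. Qed.

Lemma word_eq_repr u : word_eq (repr (pres_word u)) u.
Proof. by apply/pres_wordP; rewrite /pres_word reprK. Qed.

Lemma presW (x : presented) : x = pres_word (repr x).
Proof. by rewrite /pres_word reprK. Qed.

Definition word_inv (u : word X) : word X :=
  rev [seq (a.1, ~~ a.2) | a <- u].

Lemma word_eq_invl u : word_eq (word_inv u ++ u) [::].
Proof.
elim: u => [|[x b] u IH]; first exact: word_eq_refl.
rewrite /word_inv /= rev_cons cat_rcons -/(word_inv u) -[_ :: u]/([:: _] ++ u).
apply: (word_eq_trans _ IH); apply: word_eq_cat; first exact: word_eq_refl.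
rewrite -[_ :: _]/([:: (x, ~~ b); (x, b)] ++ u) -[u in X in word_eq _ X]cat0s.
by apply: word_eq_cat (word_eq_refl _); rewrite -{2}[b]negbK; apply: word_eq_cancel.
Qed.

Lemma word_invK u : word_inv (word_inv u) = u.
Proof.
rewrite /word_inv map_rev revK -map_comp -[RHS]map_id.
by apply: eq_map => -[x b] /=; rewrite negbK.
Qed.

Lemma word_eq_invr u : word_eq (u ++ word_inv u) [::].
Proof. by rewrite -{1}[u]word_invK; apply: word_eq_invl. Qed.

Definition pres_one : presented := pres_word [::].
Definition pres_mul (x y : presented) : presented :=
  pres_word (repr x ++ repr y).
Definition pres_inv (x : presented) : presented :=
  pres_word (word_inv (repr x)).

Lemma pres_mulE u v : pres_mul (pres_word u) (pres_word v) = pres_word (u ++ v).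
Proof. by apply/pres_wordP; apply: word_eq_cat; apply: word_eq_repr. Qed.

Let mulA : associative pres_mul.
Proof. by move=> x y z; rewrite [x]presW [y]presW [z]presW !pres_mulE catA. Qed.

Let mul1 : left_id pres_one pres_mul.
Proof. by move=> x; rewrite [x]presW pres_mulE. Qed.

Let mulr1 : right_id pres_one pres_mul.
Proof. by move=> x; rewrite [x]presW pres_mulE cats0. Qed.

Let mulV : left_inverse pres_one pres_inv pres_mul.
Proof.
move=> x; rewrite {2}[x]presW pres_mulE.
by apply/pres_wordP; apply: word_eq_invl.
Qed.

Let mulrV : right_inverse pres_one pres_inv pres_mul.
Proof.
move=> x; rewrite {1}[x]presW pres_mulE.
by apply/pres_wordP; apply: word_eq_invr.
Qed.

HB.instance Definition _ := isGroup.Build presented mulA mul1 mulr1 mulV mulrV.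

Lemma pres_wordM u v : pres_word (u ++ v) = pres_word u * pres_word v.
Proof. by rewrite -pres_mulE. Qed.

Lemma pres_wordV u : pres_word (word_inv u) = (pres_word u)^-1.
Proof.
apply/esym/mulg1_eq; rewrite -pres_wordM.
by apply/pres_wordP; apply: word_eq_invr.
Qed.

Lemma pres_word_nseq n x : pres_word (nseq n (x, true)) = pres_gen x ^+ n.
Proof. by elim: n => // n IH; rewrite expgS -IH -pres_wordM. Qed.

Section Lift.
Variables (H : groupType) (f : X -> H).

Definition word_eval (u : word X) : H :=
  \prod_(a <- u) (if a.2 then f a.1 else (f a.1)^-1).

Definition pres_lift (x : presented) : H := word_eval (repr x).

Hypothesis fR : forall u v, R u v -> word_eval u = word_eval v.

Lemma word_eval_eq u v : word_eq u v -> word_eval u = word_eval v.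
Proof.
elim=> // {u v} [u v w _ -> _ ->|u u' v v' _ uu' _ vv'|x b] //.
- by rewrite /word_eval !big_cat /= -/(word_eval _) uu' -/(word_eval _) vv'.
- rewrite /word_eval !big_cons !big_nil /= mulg1.
  by case: b => /=; rewrite (mulgV, mulVg).
Qed.

Lemma pres_lift_word u : pres_lift (pres_word u) = word_eval u.
Proof. exact/word_eval_eq/word_eq_repr. Qed.

Lemma pres_lift_gen x : pres_lift (pres_gen x) = f x.
Proof. by rewrite pres_lift_word /word_eval big_seq1. Qed.

Lemma pres_lift_monoid_morphism : monoid.monoid_morphism pres_lift.
Proof.
split=> [|x y]; first by rewrite -[1]/(pres_word [::]) pres_lift_word /word_eval big_nil.
by rewrite [x]presW [y]presW -pres_wordM !pres_lift_word /word_eval big_cat.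
Qed.

End Lift.
End Presentation.

(* The limit is the disjoint union of the G m modulo the relation identifying
   two elements that become equal after finitely many transition maps.  Two
   elements of levels m and n are multiplied after moving both to level
   m + n. *)
Section InductiveLimit.
Variables (G : nat -> groupType).
Variable (f : forall m, UMagmaMorphism.type (G m) (G m.+1)).

Let T := {m : nat & G m}.

Definition lim_step (u : T) : T := Tagged G (f _ (tagged u)).

Definition lim_rel (u v : T) : bool :=
  `[< exists a b, iter a lim_step u = iter b lim_step v >].

Let rel_refl : reflexive lim_rel.
Proof. by move=> u; apply/asboolP; exists 0%N, 0%N. Qed.

Let rel_sym : symmetric lim_rel.
Proof. by move=> u v; apply/asboolP/asboolP => -[a [b e]]; exists b, a. Qed.

Let rel_trans : transitive lim_rel.
Proof.
move=> v u w /asboolP[a [b e]] /asboolP[c [d e']]; apply/asboolP.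
by exists (c + a)%N, (b + d)%N; rewrite iterD e -iterD addnC iterD e' -iterD.
Qed.

Canonical lim_equiv := EquivRel lim_rel rel_refl rel_sym rel_trans.

Definition indlim := {eq_quot lim_equiv}%qT.

HB.instance Definition _ := Choice.on indlim.
HB.instance Definition _ := EqQuotient.on indlim.

Definition lim_class (u : T) : indlim := (\pi_indlim u)%qT.

Definition lim_in m (x : G m) : indlim := lim_class (Tagged G x).

Lemma lim_classP u v :
  lim_class u = lim_class v <->
  exists a b, iter a lim_step u = iter b lim_step v.
Proof. by split=> [/eqmodP/asboolP|uv] //; apply/eqmodP/asboolP. Qed.

Lemma lim_classW (x : indlim) : x = lim_class (repr x).
Proof. by rewrite /lim_class reprK. Qed.

Lemma lim_in_step m (x : G m) : lim_in (f m x) = lim_in x.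
Proof. by apply/lim_classP; exists 0%N, 1%N. Qed.

Lemma lim_class_iter n u : lim_class (iter n lim_step u) = lim_class u.
Proof. by apply/lim_classP; exists 0%N, n. Qed.

Lemma tag_iter n u : tag (iter n lim_step u) = (n + tag u)%N.
Proof. by elim: n => //= n ->. Qed.

(* Meaningful when u and v have the same level. *)
Definition level_mul (u v : T) : T := Tagged G (tagged u * tagged_as u v).

Lemma level_mul_step u v :
  tag u = tag v -> lim_step (level_mul u v) = level_mul (lim_step u) (lim_step v).
Proof.
case: u v => [m x] [n y] /= e; case: n / e y => y.
by rewrite /level_mul /lim_step /= !tagged_asE /= gmulfM.
Qed.

Lemma level_mul_iter n u v : tag u = tag v ->
  iter n lim_step (level_mul u v)
  = level_mul (iter n lim_step u) (iter n lim_step v).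
Proof. by move=> e; elim: n => //= n ->; rewrite level_mul_step // !tag_iter e. Qed.

Definition total_mul (u v : T) : T :=
  level_mul (iter (tag v) lim_step u) (iter (tag u) lim_step v).

Lemma total_mulE a b u v : (a + tag u = b + tag v)%N ->
  lim_class (total_mul u v)
  = lim_class (level_mul (iter a lim_step u) (iter b lim_step v)).
Proof.
move=> e; apply/lim_classP; exists (a + tag u)%N, (tag u + tag v)%N.
rewrite !level_mul_iter -?iterD ?tag_iter //; last by rewrite addnC.
by congr (level_mul (iter _ _ _) (iter _ _ _)); lia.
Qed.

Lemma total_mul_eq u u' v v' : lim_class u = lim_class u' ->
  lim_class v = lim_class v' ->
  lim_class (total_mul u v) = lim_class (total_mul u' v').
Proof.
move=> /lim_classP[a [a' ea]] /lim_classP[b [b' eb]].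
have ta : (a + tag u = a' + tag u')%N by rewrite -!tag_iter ea.
have tb : (b + tag v = b' + tag v')%N by rewrite -!tag_iter eb.
rewrite (@total_mulE (b + tag v + a) (a + tag u + b)); last by lia.
rewrite [RHS](@total_mulE (b + tag v + a') (a + tag u + b')); last by lia.
by rewrite !(iterD (b + tag v)) !(iterD (a + tag u)) ea eb.
Qed.

Definition lim_one : indlim := lim_in (1 : G 0%N).
Definition lim_mul (x y : indlim) : indlim :=
  lim_class (total_mul (repr x) (repr y)).
Definition lim_inv (x : indlim) : indlim := lim_in (tagged (repr x))^-1.

Lemma lim_mul_class u v :
  lim_mul (lim_class u) (lim_class v) = lim_class (total_mul u v).
Proof. by apply: total_mul_eq; rewrite -lim_classW. Qed.

Lemma lim_mul_in m (x y : G m) : lim_mul (lim_in x) (lim_in y) = lim_in (x * y).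
Proof.
by rewrite lim_mul_class (@total_mulE 0%N 0%N) // /level_mul /= tagged_asE.
Qed.

Lemma lim_in_iter n m (x : G m) : exists y : G (n + m)%N, lim_in x = lim_in y.
Proof.
elim: n => [|n [y ->]]; first by exists x.
by exists (f _ y); rewrite lim_in_step.
Qed.

Lemma lim_inP (x : indlim) : exists m (y : G m), x = lim_in y.
Proof. by rewrite [x]lim_classW; case: (repr x) => m y; exists m, y. Qed.

Lemma lim_in2P (x y : indlim) :
  exists m (x' y' : G m), x = lim_in x' /\ y = lim_in y'.
Proof.
have [m [x1 ->]] := lim_inP x; have [n [y1 ->]] := lim_inP y.
have [x2 ex] := lim_in_iter n x1; have [y2 ey] := lim_in_iter m y1.
by rewrite addnC in y2 ey; exists (n + m)%N, x2, y2.
Qed.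

Lemma lim_in1 m : lim_in (1 : G m) = lim_one.
Proof.
by elim: m => // m IH; rewrite -IH -[in RHS]lim_in_step gmulf1.
Qed.

Let mulA : associative lim_mul.
Proof.
move=> x y z; have [m [x1 [y1 [-> ->]]]] := lim_in2P x y.
have [n [z1 ->]] := lim_inP z.
have [x2 ->] := lim_in_iter n x1; have [y2 ->] := lim_in_iter n y1.
have [z2 ->] := lim_in_iter m z1; rewrite addnC in z2 *.
by rewrite !lim_mul_in mulgA.
Qed.

Let mul1 : left_id lim_one lim_mul.
Proof.
by move=> x; have [m [y ->]] := lim_inP x; rewrite -(lim_in1 m) lim_mul_in mul1g.
Qed.

Let mulr1 : right_id lim_one lim_mul.
Proof.
by move=> x; have [m [y ->]] := lim_inP x; rewrite -(lim_in1 m) lim_mul_in mulg1.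
Qed.

Lemma lim_classE u : lim_class u = lim_in (tagged u).
Proof. by case: u. Qed.

Let mulV : left_inverse lim_one lim_inv lim_mul.
Proof.
move=> x; rewrite {2}[x]lim_classW lim_classE lim_mul_in mulVg.
exact: lim_in1.
Qed.

Let mulrV : right_inverse lim_one lim_inv lim_mul.
Proof.
move=> x; rewrite {1}[x]lim_classW lim_classE lim_mul_in mulgV.
exact: lim_in1.
Qed.

HB.instance Definition _ := isGroup.Build indlim mulA mul1 mulr1 mulV mulrV.

Lemma lim_inM m (x y : G m) : lim_in (x * y) = lim_in x * lim_in y.
Proof. by rewrite -lim_mul_in. Qed.

HB.instance Definition _ m :=
  isUMagmaMorphism.Build (G m) indlim (@lim_in m) (lim_in1 m, @lim_inM m).

Definition indlim_set (A : forall m, set (G m)) : set indlim :=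
  \bigcup_m (@lim_in m @` A m).

End InductiveLimit.

Section Tower.
Variables (k l : int -> nat).

Definition tower_idx (m : nat) := {i : int | (- m%:Z <= i <= m%:Z)%R}.

Variant tower_rel m : word (tower_idx m) -> word (tower_idx m) -> Prop :=
| TowerRel (i j : tower_idx m) : val j = (val i + 1)%R ->
    tower_rel (nseq (k (val j)) (i, true)) (nseq (l (val j)) (j, true)).

Definition tower m : groupType := presented (@tower_rel m).

(* The generator g_i of G_(m); the value 1 for i outside [-m, m] is a dummy. *)
Definition tower_gen m (i : int) : tower m :=
  if insub i is Some x then pres_gen (@tower_rel m) x else 1.

Lemma tower_genE m (x : tower_idx m) :
  tower_gen m (val x) = pres_gen (@tower_rel m) x.
Proof. by rewrite /tower_gen valK. Qed.

Lemma tower_idxP m (i : int) : (- m%:Z <= i <= m%:Z)%R ->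
  exists x : tower_idx m, val x = i.
Proof. by move=> hi; exists (Sub i hi). Qed.

Lemma tower_gen_rel m (i : int) : (- m%:Z + 1 <= i <= m%:Z)%R ->
  tower_gen m (i - 1)%R ^+ k i = tower_gen m i ^+ l i.
Proof.
move=> hi; have [|x hx] := @tower_idxP m (i - 1)%R; first by lia.
have [|y hy] := @tower_idxP m i; first by lia.
rewrite -hx -{2 3}hy -{1}hy !tower_genE -!pres_word_nseq.
by apply/pres_wordP/word_eq_rel/TowerRel; rewrite hx hy subrK.
Qed.

Definition tower_map m : tower m -> tower m.+1 :=
  pres_lift (fun i : tower_idx m => tower_gen m.+1 (val i)).

Lemma tower_map_rel m u v : @tower_rel m u v ->
  word_eval (fun i : tower_idx m => tower_gen m.+1 (val i)) u
  = word_eval (fun i : tower_idx m => tower_gen m.+1 (val i)) v.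
Proof.
case=> i j ji; rewrite /word_eval !big_nseq /= !iter_mulg_1.
have -> : val i = (val j - 1)%R by rewrite ji addrK.
apply: tower_gen_rel; have := valP i; have := valP j; rewrite /= ji; lia.
Qed.

HB.instance Definition _ m := isUMagmaMorphism.Build (tower m) (tower m.+1)
  (@tower_map m) (pres_lift_monoid_morphism (@tower_map_rel m)).

Lemma tower_map_gen m (i : int) : (- m%:Z <= i <= m%:Z)%R ->
  tower_map (tower_gen m i) = tower_gen m.+1 i.
Proof.
move=> /tower_idxP[x <-]; rewrite tower_genE.
exact: (pres_lift_gen (@tower_map_rel m)).
Qed.

(* The element g_{-m}^{-k_{-m+1}+1} ... g_{i-1}^{-k_i+1} g_i; since k is positive,
   the exponent -k+1 is the opposite of the natural number k - 1. *)
Definition tower_twist m (i : int) : tower m :=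
  \prod_(0 <= s < `|(i + m%:Z)%R|%N)
     tower_gen m (- m%:Z + s%:Z)%R ^- (k (- m%:Z + s%:Z + 1)%R - 1)
  * tower_gen m i.

Definition tower_cone m : set (tower m) :=
  semigroup_gen ([set tower_gen m (- m%:Z)%R]
    `|` [set tower_twist m i | i in [set i : int | (- m%:Z + 1 <= i <= m%:Z)%R]]).

Lemma tower_map_twist m (i : int) : (- m%:Z + 1 <= i <= m%:Z)%R ->
  tower_map (tower_twist m i)
  = tower_gen m.+1 (- m.+1%:Z)%R ^+ (k (- m%:Z)%R - 1) * tower_twist m.+1 i.
Proof.
move=> hi; rewrite /tower_twist gmulfM gmulf_prod /= tower_map_gen; last by lia.
have -> : `|(i + m.+1%:Z)%R|%N = (`|(i + m%:Z)%R|%N).+1 by lia.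
rewrite big_nat_recl //= addr0.
have -> : (- m.+1%:Z + 1 = - m%:Z)%R by lia.
rewrite -!mulgA mulVKg; congr (_ * _); apply: eq_big_nat => s hs.
rewrite gmulfXVn /= tower_map_gen; last by lia.
by have -> : (- m.+1%:Z + s.+1%:Z = - m%:Z + s%:Z)%R by lia.
Qed.

Lemma tower_cone_map m (x : tower m) :
  tower_cone x -> tower_cone (tower_map x).
Proof.
have semi n : subsemigroup (@tower_cone n).
  by move=> a b aP bP A hA; apply: (hA.1); [apply: aP|apply: bP].
have gen n a : tower_cone (tower_gen n (- n%:Z)%R ^+ a.+1).
  elim: a => [|a IH]; first by apply: sub_gen_smallest; left.
  by rewrite expgS; apply: semi => //; apply: sub_gen_smallest; left.
have genM n a y : tower_cone y -> tower_cone (tower_gen n (- n%:Z)%R ^+ a * y).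
  by case: a => [|a] yP; rewrite ?expg0 ?mul1g //; apply: semi.
have twist n (i : int) : (- n%:Z + 1 <= i <= n%:Z)%R -> tower_cone (tower_twist n i).
  by move=> hi; apply: sub_gen_smallest; right; exists i.
move=> xP; apply: (xP [set y | tower_cone (tower_map y)]); split.
  by move=> a b /= aP bP; rewrite gmulfM; apply: semi.
move=> _ [->|[i /= hi <-]] /=; last first.
  by rewrite tower_map_twist //; apply: genM; apply: twist; lia.
rewrite tower_map_gen; last by lia.
have -> : tower_gen m.+1 (- m%:Z)%R
    = tower_gen m.+1 (- m.+1%:Z)%R ^+ (k (- m%:Z)%R - 1)
      * tower_twist m.+1 (- m%:Z)%R.
  rewrite /tower_twist; have -> : `|(- m%:Z + m.+1%:Z)%R|%N = 1%N by lia.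
  rewrite big_nat1 addr0; have -> : (- m.+1%:Z + 1 = - m%:Z)%R by lia.
  by rewrite mulVKg.
by apply: genM; apply: twist; lia.
Qed.

Definition tower_lim : groupType :=
  indlim (fun m => @tower_map m : UMagmaMorphism.type _ _).

Definition tower_lim_cone : set tower_lim := indlim_set tower_cone.

End Tower.

Arguments tower_cone : clear implicits.
Arguments tower_lim_cone : clear implicits.

(* Main.v *)
Require Import Defs.
From HB Require Import structures.
From mathcomp Require Import all_boot all_order all_algebra.
From mathcomp Require Import finmap all_classical topology.
From mathcomp Require Import zify ring lra.
Set Implicit Arguments.
Unset Strict Implicit.
Unset Printing Implicit Defensive.
Import Order.TTheory GRing.Theory Num.Theory.

(** Number the generators of G_(m) from left to right as g_0, ..., g_n, with
    relations g_i^(K i) = g_(i+1)^(L i).  The generators of the cone are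
    a_i = g_0^(1 - K 0) ... g_(i-1)^(1 - K (i-1)) g_i; each g_i is a positive
    word in a_0, ..., a_i, and the relations become triangular:
    a_i = a_(i+1) g_(i+1)^(L i - 1).  So a_n is the smallest generator for left
    divisibility.

    Every element other than 1 is positive or negative.  In the monoid with
    this triangular presentation, two elements with a common right multiple are
    comparable for left divisibility ([eqw_comparable]): a relation applied at
    the front of a word only exchanges its first letter for the next one, and
    these steps disappear when all first letters are written through the
    largest of them ([conv_climb]), which allows an induction on the number of
    steps.  A power of g_0 is central in the monoid and is a right multiple of
    every letter, so any two words have a common right multiple and every
    element of the group is a fraction u^-1 v of words
    ([fraction_comparable]).

    No element is both positive and negative.  The group acts on the ordered
    set of rational numbers so that every a_i moves 0 to the right; then so
    does every nonempty product of the a_i ([level_cone1]).  The action is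
    built one generator at a time ([realizes_extend]).  Given g_0, ..., g_n, the
    next generator has to be an (L n)-th root of T = g_n^(K n) which sends 0
    beyond w 0, where w = g_n^(K n - 1) ... g_0^(K 0 - 1).  That a_n moves 0 to
    the right says precisely that w 0 < T 0, and as T is conjugate to a
    translation it has roots sending 0 to any point between 0 and T 0
    ([conj_transl_root]).

    The two facts show that P_(m) is a positive cone, that it is the trace of
    P_(m+1) on G_(m), and hence that the union P_(oo) is a positive cone.

    Approximation by conjugates.  A neighbourhood of the ordering is given by
    finitely many positive elements, which lie in a common G_(m).  Let p be the
    least positive element of G_(m), namely its a_n.  If x is positive in
    G_(m), then p^-1 x is 1 or positive, so p^-1 x p is positive: the conjugate
    ordering by p lies in the neighbourhood.  If it were the original ordering,
    conjugation by p would fix the least positive element q of G_(m+1)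
    ([min_conj_commute]).  But q = u y, where y is the last generator of
    G_(m+1) and u belongs to the subgroup generated by the other ones.  In the
    action above the root y may be chosen with a prescribed value at the second
    point p 0, whereas p q = q p would force that value
    ([realizes_noncommuting]). *)

(** * Left divisibility in monoids with a triangular presentation *)
Section TriangularMonoid.
Variables (K L : nat -> nat) (n : nat).

Definition wrep (T : Type) e (w : seq T) : seq T := flatten (nseq e w).

Lemma wrepS (T : Type) e (w : seq T) : wrep e.+1 w = w ++ wrep e w.
Proof. by []. Qed.

Lemma wrepD (T : Type) d e (w : seq T) : wrep (d + e) w = wrep d w ++ wrep e w.
Proof. by elim: d => // d IH; rewrite addSn !wrepS IH catA. Qed.

Lemma wrepM (T : Type) d e (w : seq T) : wrep (d * e) w = wrep d (wrep e w).
Proof. by elim: d => // d IH; rewrite mulSn wrepD IH. Qed.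

Lemma wrepSr (T : Type) e (w : seq T) : wrep e.+1 w = wrep e w ++ w.
Proof. by rewrite -addn1 wrepD /wrep /= cats0. Qed.

Lemma all_wrep (T : Type) (p : pred T) e w : all p w -> all p (wrep e w).
Proof. by move=> pw; elim: e => // e IH; rewrite wrepS all_cat pw. Qed.

(** With the letter i standing for a_i, shift_word i represents
    g_(i-1)^(K (i-1) - 1) ... g_0^(K 0 - 1), gen_word i represents g_i, and
    tail_word i represents the quotient of a_i by a_(i+1). *)
Fixpoint shift_word i : seq nat :=
  if i is j.+1 then wrep (K j - 1) (rcons (shift_word j) j) ++ shift_word j
  else [::].

Definition gen_word i : seq nat := rcons (shift_word i) i.

Definition tail_word i : seq nat := wrep (L i - 1) (gen_word i.+1).

(** The letter i may be exchanged for the word i.+1 :: tail_word i.  Only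
    letters up to n are involved. *)
Inductive step : seq nat -> seq nat -> Prop :=
| step_up x y i : (i < n)%N -> step (x ++ i :: y) (x ++ i.+1 :: tail_word i ++ y)
| step_down x y i : (i < n)%N -> step (x ++ i.+1 :: tail_word i ++ y) (x ++ i :: y).

Lemma step_sym u v : step u v -> step v u.
Proof. by case=> x y i hi; constructor. Qed.

Lemma step_cat x y u v : step u v -> step (x ++ u ++ y) (x ++ v ++ y).
Proof.
by case=> s t i hi; rewrite -!catA /= -?catA !(catA x); constructor.
Qed.

Lemma step_head a u v : step (a :: u) v ->
  [\/ exists2 u', v = a :: u' & step u u',
      (a < n)%N /\ v = a.+1 :: tail_word a ++ u
    | exists i u', [/\ (i < n)%N, a = i.+1, u = tail_word i ++ u' & v = i :: u']].
Proof.
move eu: (a :: u) => au st; case: st eu => x y i hi; case: x => [|b x] //=.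
- by case=> -> ->; apply: Or32.
- case=> <- ->; apply: Or31.
  by exists (x ++ i.+1 :: tail_word i ++ y); last constructor.
- by case=> -> ->; apply: Or33; exists i, y.
- by case=> <- ->; apply: Or31; exists (x ++ i :: y); last constructor.
Qed.

(** The number of steps is recorded because the divisibility arguments are
    inductions on it. *)
Fixpoint conv N (u v : seq nat) : Prop :=
  if N is N'.+1 then exists2 w, step u w & conv N' w v else u = v.

Lemma conv_trans M N u v w : conv M u v -> conv N v w -> conv (M + N) u w.
Proof.
elim: M u => [|M IH] u /=; first by move=> ->.
by case=> x ux xv vw; exists x => //; apply: IH.
Qed.

Lemma conv_sym N u v : conv N u v -> conv N v u.
Proof.
elim: N u => [|N IH] u; first by move=> ->.
case=> x /step_sym xu xv; rewrite -addn1; apply: conv_trans (IH _ xv) _.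
by exists u.
Qed.

Lemma conv_cat x y N u v : conv N u v -> conv N (x ++ u ++ y) (x ++ v ++ y).
Proof.
elim: N u => [|N IH] u /=; first by move=> ->.
by case=> w uw wv; exists (x ++ w ++ y); [apply: step_cat|apply: IH].
Qed.

Lemma conv_catl x N u v : conv N u v -> conv N (x ++ u) (x ++ v).
Proof. by move=> /(@conv_cat x [::]); rewrite !cats0. Qed.

(** climb a b is the word with a = b :: climb a b in the monoid, for a <= b. *)
Fixpoint climb_from a d : seq nat :=
  if d is d'.+1 then climb_from a.+1 d' ++ tail_word a else [::].

Definition climb a b := climb_from a (b - a).

Lemma climbxx a : climb a a = [::].
Proof. by rewrite /climb subnn. Qed.

Lemma climbS a b : (a < b)%N -> climb a b = climb a.+1 b ++ tail_word a.
Proof. by move=> ab; rewrite /climb -subnSK. Qed.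

Lemma climb_cat a b c : (a <= b <= c)%N -> climb a c = climb b c ++ climb a b.
Proof.
move=> /andP[]; move e: (b - a)%N => d; elim: d a e => [|d IH] a e ab bc.
  by have -> : a = b; [lia|rewrite climbxx cats0].
rewrite (climbS (a := a)) 1?[climb a b]climbS; [|lia|lia].
by rewrite catA -IH //; lia.
Qed.

(** Let J be the largest first letter met along the derivation, and write every
    first letter through J.  Because climb a J = climb a.+1 J ++ tail_word a,
    the two sides of a step at the front become the same word, so that such
    steps vanish.  Hence the derivation gets shorter, unless no first letter
    ever changes. *)
Lemma conv_climb N a b u v : conv N (a :: u) (b :: v) ->
  exists J M, [/\ (a <= J)%N, (b <= J)%N, conv M (climb a J ++ u) (climb b J ++ v)
    & (M < N)%N \/ [/\ M = N, a = J & b = J]].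
Proof.
elim: N a u => [|N IH] a u /=.
  by case=> -> ->; exists b, 0%N; split=> //; right.
case=> w /step_head[[u' -> uu']|[an ->]|[i [u' [lt_in -> -> ->]]]].
- move=> /IH[J [M [aJ bJ c MN]]]; exists J, M.+1; split=> //.
    exists (climb a J ++ u') => //.
    by have := step_cat (climb a J) [::] uu'; rewrite !cats0.
  by case: MN => [MN|[-> ? ?]]; [left|right].
- move=> /IH[J [M [aJ bJ c MN]]]; exists J, M; split=> //; first exact: ltnW.
    by rewrite climbS // -catA.
  by left; case: MN => [|[]]; lia.
- move=> /IH[J [M [iJ bJ c MN]]]; have MN1 : (M < N.+1)%N by case: MN => [|[]]; lia.
  case: (ltnP i J) => [lt_iJ|le_Ji].
    by exists J, M; split=> //; [rewrite catA -climbS|left].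
  have eJ : J = i by lia.
  exists i.+1, M; split; [by []|by lia| |by left].
  rewrite climbxx cat0s (@climb_cat b i i.+1); last by lia.
  rewrite [climb i _]climbS // climbxx cat0s -catA; apply: conv_catl.
  by move: c; rewrite eJ climbxx.
Qed.

(** The prefix climb a J that replaces the letter a may be longer than the
    prefix to be cancelled; what decreases is the number of steps. *)
Lemma conv_cancel w N u v : conv N (w ++ u) (w ++ v) ->
  exists2 M, (M <= N)%N & conv M u v.
Proof.
elim/ltn_ind: N w u v => N IHN; elim=> [|a w IHw] u v; first by exists N.
move=> /conv_climb[J [M [_ _ c]]] [MN|[eM eJ _]].
  have [M' MM' c'] := IHN _ MN _ _ _ c.
  have [M'' MM'' c''] := IHN M' ltac:(lia) _ _ _ c'.
  by exists M'' => //; lia.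
by move: c; rewrite eM -eJ climbxx; apply: IHw.
Qed.

Lemma conv_head N a b u v : (a <= b)%N -> conv N (a :: u) (b :: v) ->
  exists M, conv M (climb a b ++ u) v /\ ((M < N)%N \/ (M = N /\ a = b)).
Proof.
move=> ab /conv_climb[J [M [aJ bJ c MN]]].
rewrite (@climb_cat a b J) ?ab // -catA in c.
have [M' MM' c'] := conv_cancel c; exists M'; split=> //.
by case: MN => [|[]]; lia.
Qed.

Lemma all_shift_word i j : (i <= j.+1)%N -> all (leq^~ j) (shift_word i).
Proof.
elim: i => //= i IH ij; rewrite all_cat all_wrep ?IH //; try lia.
by rewrite all_rcons /= IH; lia.
Qed.

Lemma all_gen_word i j : (i <= j)%N -> all (leq^~ j) (gen_word i).
Proof. by move=> ij; rewrite all_rcons /= ij all_shift_word //; lia. Qed.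

Lemma all_climb a b : (b <= n)%N -> all (leq^~ n) (climb a b).
Proof.
rewrite /climb; move e: (b - a)%N => d; elim: d a e => //= d IH a e bn.
by rewrite all_cat IH ?all_wrep ?all_gen_word //; lia.
Qed.

Lemma step_all u v : step u v -> all (leq^~ n) u = all (leq^~ n) v.
Proof.
have tailn i : (i < n)%N -> all (leq^~ n) (tail_word i).
  by move=> lt_in; rewrite all_wrep ?all_gen_word.
case=> x y i lt_in; rewrite !all_cat /= all_cat tailn //= (ltnW lt_in) lt_in //.
Qed.

Lemma conv_all N u v : conv N u v -> all (leq^~ n) u = all (leq^~ n) v.
Proof. by elim: N u => [|N IH] u /= => [->|[w /step_all-> /IH]]. Qed.

Definition eqw u v := exists N, conv N u v.

Lemma eqw_refl u : eqw u u. Proof. by exists 0%N. Qed.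

Lemma eqw_sym u v : eqw u v -> eqw v u.
Proof. by case=> N c; exists N; apply: conv_sym. Qed.

Lemma eqw_trans v u w : eqw u v -> eqw v w -> eqw u w.
Proof. by case=> M uv [N vw]; exists (M + N)%N; apply: conv_trans uv vw. Qed.

Lemma eqw_cat u u' v v' : eqw u u' -> eqw v v' -> eqw (u ++ v) (u' ++ v').
Proof.
case=> M uu' [N vv']; apply: (@eqw_trans (u' ++ v)).
  by exists M; apply: (conv_cat [::] v uu').
by exists N; apply: conv_catl.
Qed.

Lemma eqw_catl u v v' : eqw v v' -> eqw (u ++ v) (u ++ v').
Proof. by apply: eqw_cat; apply: eqw_refl. Qed.

Lemma eqw_catr v u u' : eqw u u' -> eqw (u ++ v) (u' ++ v).
Proof. by move=> uu'; apply: eqw_cat (eqw_refl v). Qed.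

Lemma eqw_rep e u u' : eqw u u' -> eqw (wrep e u) (wrep e u').
Proof.
by move=> uu'; elim: e => [|e IH]; [apply: eqw_refl|apply: eqw_cat].
Qed.

Lemma eqw_cancel w u v : eqw (w ++ u) (w ++ v) -> eqw u v.
Proof. by case=> N /conv_cancel[M _ c]; exists M. Qed.

Lemma eqw_climb a b : (a <= b <= n)%N -> eqw [:: a] (b :: climb a b).
Proof.
move=> /andP[]; move e: (b - a)%N => d; elim: d a e => [|d IH] a e ab bn.
  by have -> : a = b; [lia|rewrite climbxx; apply: eqw_refl].
rewrite climbS; last by lia.
apply: (@eqw_trans (a.+1 :: tail_word a)).
  exists 1%N => /=; exists (a.+1 :: tail_word a) => //.
  by have := @step_up [::] [::] a; rewrite /= cats0; apply; lia.
by have := IH a.+1 ltac:(lia) ltac:(lia) bn; apply: (@eqw_catr (tail_word a)).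
Qed.

(** Left divisibility is linear among the left divisors of a given element.
    When the first letters a < b differ, a is rewritten as b :: climb a b and b
    is cancelled; this lengthens the word but shortens the derivation.  When
    they agree they are cancelled, and the words get shorter. *)
Lemma eqw_comparable u v u' v' : all (leq^~ n) u -> all (leq^~ n) v ->
  eqw (u ++ u') (v ++ v') ->
  exists2 t, all (leq^~ n) t & eqw (u ++ t) v \/ eqw (v ++ t) u.
Proof.
move=> un vn c; suff [t ht] : exists t, eqw (u ++ t) v \/ eqw (v ++ t) u.
  exists t => //; case: ht => -[N /conv_all]; rewrite all_cat.
    by rewrite vn => /andP[].
  by rewrite un => /andP[].
suff main N : forall s u v u' v', (size u + size v <= s)%N ->
    all (leq^~ n) u -> all (leq^~ n) v -> conv N (u ++ u') (v ++ v') ->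
  exists t, eqw (u ++ t) v \/ eqw (v ++ t) u.
  by case: c => N c; apply: (main N _ u v u' v') (leqnn _) _ _ c.
elim/ltn_ind: N {un vn c} => N IHN; elim=> [|s IHs] {}u {}v {}u' {}v'.
  by case: u => // _ _ _ _; exists v; left; apply: eqw_refl.
(* The default 0 only concerns empty words, which are dealt with below. *)
wlog: u v u' v' / (head 0 u <= head 0 v)%N => [wlg suv un vn c|].
  case: (leqP (head 0 u) (head 0 v)) => [h|/ltnW h]; first exact: (wlg _ _ _ _ h) c.
  have [|t [h1|h1]] := wlg _ _ _ _ h _ vn un (conv_sym c); first by lia.
    by exists t; right.
  by exists t; left.
case: u => [|a u] /=; first by exists v; left; apply: eqw_refl.
case: v => [|b v] /=; first by exists (a :: u); right; apply: eqw_refl.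
move=> ab suv /andP[an un] /andP[bn vn] c.
have lift t w : eqw (climb a b ++ u ++ t) w -> eqw (a :: u ++ t) (b :: w).
  move=> h; apply: (@eqw_trans ([:: b] ++ climb a b ++ u ++ t)); last exact: eqw_catl.
  by rewrite catA; apply: (@eqw_catr _ [:: a]); apply: eqw_climb; rewrite ab.
have [M [cM MN]] := conv_head ab c.
suff [t [h|h]] : exists t,
    eqw ((climb a b ++ u) ++ t) v \/ eqw (v ++ t) (climb a b ++ u).
- by exists t; left; apply: lift; rewrite catA.
- exists t; right; apply: eqw_sym; rewrite -[u]cats0; apply: lift.
  by rewrite cats0; apply: eqw_sym.
rewrite catA in cM; case: MN => [MN|[eM eab]].
  by apply: (IHN _ MN _ _ _ _ _ (leqnn _)) cM; rewrite // all_cat un all_climb.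
move: cM; rewrite eM eab climbxx cat0s; apply: IHs => //.
by move: suv; rewrite addSn addnS => /ltnW.
Qed.

Hypotheses (K_gt0 : forall i, (0 < K i)%N) (L_gt0 : forall i, (0 < L i)%N).

(** The relation between g_i and g_(i+1) holds already in the monoid: write
    g_(i+1)^(L i) as shift_word i.+1 followed by a_(i+1) g_(i+1)^(L i - 1),
    which is a_i. *)
Lemma eqw_gen_rel i : (i < n)%N ->
  eqw (wrep (K i) (gen_word i)) (wrep (L i) (gen_word i.+1)).
Proof.
move=> lt_in; rewrite -[L i]prednK // wrepS -subn1 -/(tail_word i).
have -> : wrep (K i) (gen_word i) = shift_word i.+1 ++ [:: i].
  by rewrite -[in LHS](prednK (K_gt0 i)) wrepSr /= -catA cats1 subn1.
rewrite /gen_word -cats1 -catA; apply: eqw_catl.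
by have := @eqw_climb i i.+1; rewrite leqnSn /= climbS // climbxx; apply.
Qed.

(** This power of g_0 is also a power of every other g_i, which makes it
    central. *)
Definition central_word := wrep (\prod_(0 <= j < n) K j) (gen_word 0).

Lemma central_word_power i : (i <= n)%N ->
  exists e, eqw central_word (wrep (e * \prod_(i <= j < n) K j) (gen_word i)).
Proof.
elim: i => [|i IH] lt_in; first by exists 1%N; rewrite mul1n; apply: eqw_refl.
have [e he] := IH (ltnW lt_in); exists (e * L i)%N; apply: eqw_trans he _.
rewrite big_ltn // [(K i * _)%N]mulnC mulnA [(e * L i * _)%N]mulnAC !(wrepM (e * _)).
by apply: eqw_rep; apply: eqw_gen_rel.
Qed.

Definition commw u v := eqw (u ++ v) (v ++ u).

Lemma commw_cat u v w : commw u v -> commw u w -> commw u (v ++ w).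
Proof.
move=> uv uw; rewrite /commw catA; apply: eqw_trans (eqw_catr w uv) _.
by rewrite -!catA; apply: eqw_catl.
Qed.

Lemma commw_rep e u v : commw u v -> commw u (wrep e v).
Proof.
move=> uv; elim: e => [|e IH]; last exact: commw_cat.
by rewrite /commw cats0; apply: eqw_refl.
Qed.

Lemma commw_gen i : (i <= n)%N -> commw central_word (gen_word i).
Proof.
move=> /central_word_power[e he]; set E := (e * _)%N in he.
apply: eqw_trans (eqw_catr _ he) _; rewrite -wrepSr wrepS.
by apply: eqw_catl; apply: eqw_sym.
Qed.

Lemma commw_shift i : (i <= n)%N -> commw central_word (shift_word i).
Proof.
elim: i => [_|i IH lt_in]; first by rewrite /commw cats0; apply: eqw_refl.
by apply: commw_cat (IH _); [apply: commw_rep; apply: commw_gen|]; apply: ltnW.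
Qed.

(** a_i itself is not a product of the g_j in the monoid, but
    g_i = shift_word i a_i there, and shift_word i can be cancelled. *)
Lemma commw_letter i : (i <= n)%N -> commw central_word [:: i].
Proof.
move=> le_in; apply: (@eqw_cancel (shift_word i)).
have := commw_gen le_in; rewrite /commw /gen_word -cats1 -catA; apply: eqw_trans.
by rewrite !catA; apply: eqw_catr; apply: eqw_sym; apply: commw_shift.
Qed.

Lemma commw_word u : all (leq^~ n) u -> commw central_word u.
Proof.
elim: u => [_|i u IH /= /andP[le_in un]].
  by rewrite /commw cats0; apply: eqw_refl.
by rewrite -cat1s; apply: commw_cat (IH un); apply: commw_letter.
Qed.

Lemma all_central_word : all (leq^~ n) central_word.
Proof. exact/all_wrep/all_gen_word. Qed.

Lemma letter_dvd_central i : (i <= n)%N ->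
  exists2 r, all (leq^~ n) r & eqw (i :: r) central_word.
Proof.
move=> le_in; have : (0 < \prod_(0 <= j < n) K j)%N by rewrite prodn_gt0.
have := all_central_word; rewrite /central_word.
case: (\prod_(0 <= j < n) K j)%N => // e.
rewrite wrepS /= => /= en _.
exists (climb 0 i ++ wrep e [:: 0%N]); first by rewrite all_cat all_climb.
have h : eqw [:: 0%N] (i :: climb 0 i) by apply: eqw_climb.
exact: (eqw_catr (wrep e [:: 0%N]) (eqw_sym h)).
Qed.

Lemma word_dvd_central u : all (leq^~ n) u ->
  exists2 r, all (leq^~ n) r & eqw (u ++ r) (wrep (size u) central_word).
Proof.
elim: u => [_|i u IH /= /andP[le_in un]]; first by exists [::]; last exact: eqw_refl.
have [r rn hr] := IH un; have [s sn hs] := letter_dvd_central le_in.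
exists (r ++ s); first by rewrite all_cat rn.
have sz : eqw (wrep (size u) central_word ++ s) (s ++ wrep (size u) central_word).
  by apply/eqw_sym/commw_rep/eqw_sym; apply: commw_word.
apply: (@eqw_trans ([:: i] ++ (wrep (size u) central_word ++ s))).
  by rewrite -/([:: i] ++ u) catA; apply: (eqw_catr s (eqw_catl [:: i] hr)).
apply: eqw_trans (eqw_catl _ sz) _.
exact: (eqw_catr (wrep (size u) central_word) hs).
Qed.

End TriangularMonoid.

(** * Fractions in a group with chained power relations *)
Section Chain.
Local Open Scope group_scope.
Variables (K L : nat -> nat) (n : nat).
Hypotheses (K_gt0 : forall i, (0 < K i)%N) (L_gt0 : forall i, (0 < L i)%N).
Variables (G : groupType) (g : nat -> G).

Definition twist_prefix i := \prod_(0 <= s < i) g s ^- (K s - 1).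

Definition twist i := twist_prefix i * g i.

Lemma twist_prefixS i : twist_prefix i.+1 = twist_prefix i * g i ^- (K i - 1).
Proof. exact: big_nat_recr. Qed.

Definition word_val (u : seq nat) := \prod_(i <- u) twist i.

Lemma word_val_cat u v : word_val (u ++ v) = word_val u * word_val v.
Proof. exact: big_cat. Qed.

Lemma word_val_cons i u : word_val (i :: u) = twist i * word_val u.
Proof. exact: big_cons. Qed.

Lemma word_val_rep e u : word_val (wrep e u) = word_val u ^+ e.
Proof.
by elim: e => [|e IH]; [exact: big_nil|rewrite wrepS word_val_cat IH expgS].
Qed.

Lemma word_val_rcons i u : word_val (rcons u i) = word_val u * twist i.
Proof. by rewrite -cats1 word_val_cat /word_val big_seq1. Qed.

Lemma word_val_shift i :
  word_val (shift_word K i) = (twist_prefix i)^-1.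
Proof.
elim: i => [|i IH]; first by rewrite /twist_prefix big_geq // invg1 [LHS]big_nil.
by rewrite /= word_val_cat word_val_rep word_val_rcons IH mulKg twist_prefixS
  invgM invgK.
Qed.

Lemma word_val_gen i : word_val (gen_word K i) = g i.
Proof. by rewrite word_val_rcons word_val_shift mulKg. Qed.

Definition nonneg x := exists2 u, all (leq^~ n) u & x = word_val u.

Hypothesis g_rel : forall i, (i < n)%N -> g i ^+ K i = g i.+1 ^+ L i.

Lemma twist_step i : (i < n)%N -> twist i = twist i.+1 * g i.+1 ^+ (L i - 1).
Proof.
move=> /g_rel e; rewrite /twist twist_prefixS -!mulgA; congr (_ * _).
by rewrite -expgS !subn1 prednK // -e -[in RHS](prednK (K_gt0 i)) expgSr mulKg.
Qed.

Lemma word_val_step u v : step K L n u v -> word_val u = word_val v.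
Proof.
have E x y i : (i < n)%N ->
    word_val (x ++ i :: y) = word_val (x ++ i.+1 :: tail_word K L i ++ y).
  move=> lt_in; rewrite !word_val_cat !word_val_cons word_val_cat; congr (_ * _).
  by rewrite /tail_word word_val_rep word_val_gen mulgA -twist_step.
by case=> x y i lt_in; [|symmetry]; apply: E.
Qed.

Lemma word_val_eqw u v : eqw K L n u v -> word_val u = word_val v.
Proof.
by case=> N; elim: N u => [|N IH] u /= => [->|[w /word_val_step-> /IH]].
Qed.

(** Every letter is a right multiple of the last one, so twist n is the least
    positive element. *)
Lemma nonneg_divl_top x i u : (i <= n)%N -> all (leq^~ n) u ->
  x = word_val (i :: u) -> nonneg ((twist n)^-1 * x).
Proof.
move=> le_in un ->; exists (climb K L i n ++ u); first by rewrite all_cat all_climb.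
have /word_val_eqw h : eqw K L n [:: i] (n :: climb K L i n).
  by apply: eqw_climb; rewrite le_in leqnn.
by rewrite -cat1s !word_val_cat h word_val_cons -mulgA mulKg.
Qed.

(** An intermediate form in which the group generated by the g_i is easily seen
    to be covered; centrality of central_word lets denominators be collected on
    the left. *)
Definition fraction x := exists u v,
  [/\ all (leq^~ n) u, all (leq^~ n) v & x = (word_val u)^-1 * word_val v].

Lemma fraction1 : fraction 1.
Proof. by exists [::], [::]; split; rewrite ?mulVg. Qed.

Lemma fractionM x c : all (leq^~ n) c -> fraction x -> fraction (x * word_val c).
Proof.
move=> cn [u [v [un vn ->]]]; exists u, (v ++ c); split=> //.
  by rewrite all_cat vn.
by rewrite word_val_cat mulgA.
Qed.

Lemma fractionV x c : all (leq^~ n) c -> fraction x ->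
  fraction (x * (word_val c)^-1).
Proof.
move=> cn [u [v [un vn ->]]].
have [r rn /word_val_eqw] := word_dvd_central K_gt0 L_gt0 cn.
rewrite word_val_cat word_val_rep; set zN := _ ^+ _ => e.
have zC w : all (leq^~ n) w -> commute zN (word_val w).
  move=> wn; apply/commute_sym/commuteX; rewrite /commute -!word_val_cat.
  by apply/word_val_eqw/eqw_sym/commw_word.
exists (wrep (size c) (central_word K n) ++ u), (v ++ r); split.
- by rewrite all_cat un all_wrep ?all_central_word.
- by rewrite all_cat vn.
(* c r is the central element zN, whose inverse can be moved to the left. *)
have -> : (word_val c)^-1 = word_val r * zN^-1 by rewrite -e invgM mulVKg.
have h : commute (word_val v * word_val r) zN^-1.
  by apply/commuteV/commute_sym; rewrite -word_val_cat; apply: zC; rewrite all_cat vn.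
by rewrite !word_val_cat word_val_rep -/zN invgM -[RHS]mulgA -h !mulgA.
Qed.

Lemma fraction_comparable x : fraction x -> nonneg x \/ nonneg x^-1.
Proof.
case=> u [v [un vn ->]].
have [u' _ hu] := word_dvd_central K_gt0 L_gt0 un.
have [v' _ hv] := word_dvd_central K_gt0 L_gt0 vn.
set Z := fun e => wrep e (central_word K n).
have h : eqw K L n (u ++ (u' ++ Z (size v))) (v ++ (v' ++ Z (size u))).
  rewrite !catA; apply: eqw_trans (eqw_catr _ hu) _.
  by rewrite -wrepD addnC wrepD; apply/eqw_sym/eqw_catr.
have [t tn [/word_val_eqw<-|/word_val_eqw<-]] := eqw_comparable un vn h.
  by left; exists t; rewrite // word_val_cat mulKg.
by right; exists t; rewrite // word_val_cat invgM invgK mulKg.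
Qed.

End Chain.

(** * Order automorphisms of the rational numbers *)
Local Open Scope ring_scope.

Record rat_auto := RatAuto {
  auto_fun :> rat -> rat;
  auto_inv : rat -> rat;
  auto_funK : cancel auto_fun auto_inv;
  auto_invK : cancel auto_inv auto_fun;
  auto_homo : {homo auto_fun : x y / x < y}
}.

HB.instance Definition _ := gen_eqMixin rat_auto.
HB.instance Definition _ := gen_choiceMixin rat_auto.

Lemma auto_le (f : rat_auto) : {mono f : x y / x <= y}.
Proof. by apply: le_mono; apply: auto_homo. Qed.

Lemma auto_lt (f : rat_auto) : {mono f : x y / x < y}.
Proof. exact: leW_mono (auto_le f). Qed.

Lemma rat_auto_ext (f h : rat_auto) : f =1 h -> f = h.
Proof.
move=> fh; have eI : auto_inv f = auto_inv h.
  by apply/funext => x; rewrite -[RHS](auto_funK f) fh auto_invK.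
have eF : auto_fun f = auto_fun h by apply/funext.
case: f h eI eF {fh} => f f' h1 h2 h3 [h h' h1' h2' h3'] /= eI eF.
by subst h h'; congr RatAuto; apply: Prop_irrelevance.
Qed.

Definition auto1 := @RatAuto id id (fun=> erefl) (fun=> erefl) (fun _ _ => id).

Program Definition auto_mul (f h : rat_auto) :=
  @RatAuto (f \o h) (auto_inv h \o auto_inv f) _ _ _.
Next Obligation. by move=> f h x /=; rewrite !auto_funK. Qed.
Next Obligation. by move=> f h x /=; rewrite !auto_invK. Qed.
Next Obligation. by move=> f h x y xy /=; rewrite !auto_lt. Qed.

Program Definition auto_V (f : rat_auto) :=
  @RatAuto (auto_inv f) f (auto_invK f) (auto_funK f) _.
Next Obligation. by move=> f x y xy; rewrite -(auto_lt f) !auto_invK. Qed.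

Lemma auto_mulA : associative auto_mul.
Proof. by move=> f h k; apply: rat_auto_ext. Qed.
Lemma auto_mul1 : left_id auto1 auto_mul.
Proof. by move=> f; apply: rat_auto_ext. Qed.
Lemma auto_mulr1 : right_id auto1 auto_mul.
Proof. by move=> f; apply: rat_auto_ext. Qed.
Lemma auto_mulV : left_inverse auto1 auto_V auto_mul.
Proof. by move=> f; apply: rat_auto_ext => x /=; rewrite auto_funK. Qed.
Lemma auto_mulrV : right_inverse auto1 auto_V auto_mul.
Proof. by move=> f; apply: rat_auto_ext => x /=; rewrite auto_invK. Qed.

HB.instance Definition _ :=
  isGroup.Build rat_auto auto_mulA auto_mul1 auto_mulr1 auto_mulV auto_mulrV.

Lemma autoM (f h : rat_auto) x : (f * h)%g x = f (h x). Proof. by []. Qed.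
Lemma autoK (f : rat_auto) x : (f^-1)%g (f x) = x. Proof. exact: auto_funK. Qed.
Lemma autoVK (f : rat_auto) x : f ((f^-1)%g x) = x. Proof. exact: auto_invK. Qed.

Lemma auto_inj (f : rat_auto) : injective f.
Proof. exact: can_inj (autoK f). Qed.

Lemma autoJ (t f : rat_auto) x : f ((t ^ f)%g x) = t (f x).
Proof. by rewrite conjgE autoM autoVK. Qed.

Program Definition transl (c : rat) :=
  @RatAuto (fun x => x + c) (fun x => x - c) _ _ _.
Next Obligation. by move=> c x; rewrite addrK. Qed.
Next Obligation. by move=> c x; rewrite subrK. Qed.
Next Obligation. by move=> c x y xy; rewrite ltrD2r. Qed.

Lemma translE c x : transl c x = x + c. Proof. by []. Qed.

Lemma translX c e : (transl c ^+ e)%g = transl (c *+ e).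
Proof.
elim: e => [|e IH]; apply: rat_auto_ext => x; first by rewrite translE mulr0n addr0.
by rewrite expgS IH autoM !translE mulrSr addrA.
Qed.

Program Definition scale c (c_gt0 : 0 < c) :=
  @RatAuto (fun x => x * c) (fun x => x / c) _ _ _.
Next Obligation. by move=> c c0 x; rewrite mulfK // gt_eqF. Qed.
Next Obligation. by move=> c c0 x; rewrite mulfVK // gt_eqF. Qed.
Next Obligation. by move=> c c0 x y xy; rewrite ltr_pM2r. Qed.

(** The identity to the right of c and the homothety of ratio s and centre c to
    its left: it corrects the value of an automorphism at one point without
    changing the values further right. *)
Definition stretch_fun (c s x : rat) := if c <= x then x else c + s * (x - c).

Lemma stretch_funK c s : 0 < s -> cancel (stretch_fun c s) (stretch_fun c s^-1).
Proof.
move=> s0 x; rewrite /stretch_fun; case: (lerP c x) => cx; first by rewrite cx.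
rewrite ifF; first by rewrite [c + s * _]addrC addrK mulKf ?gt_eqF // addrC subrK.
by apply/negbTE; rewrite -ltNge gtrDl pmulr_rlt0 // subr_lt0.
Qed.

Lemma stretch_homo c s : 0 < s -> {homo stretch_fun c s : x y / x < y}.
Proof.
move=> s0 x y xy; rewrite /stretch_fun; case: (lerP c x) => cx.
  by rewrite (le_trans cx (ltW xy)).
case: (lerP c y) => cy; last by rewrite ltrD2l ltr_pM2l // ltrD2r.
by apply: lt_le_trans cy; rewrite gtrDl pmulr_rlt0 // subr_lt0.
Qed.

Program Definition stretch c s (s_gt0 : 0 < s) :=
  @RatAuto (stretch_fun c s) (stretch_fun c s^-1) _ _ _.
Next Obligation. by move=> c s s0; apply: stretch_funK. Qed.
Next Obligation.
by move=> c s s0 x; rewrite -{1}[s]invrK stretch_funK // invr_gt0.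
Qed.
Next Obligation. by move=> c s s0; apply: stretch_homo. Qed.

Lemma auto_interpolation (s : seq (rat * rat)) :
  sorted (fun p q => (p.1 < q.1) && (p.2 < q.2)) s ->
  exists f : rat_auto, {in s, forall p, f p.1 = p.2}.
Proof.
elim: s => [_|p [|q s] IH]; first by exists auto1.
  move=> _; exists (transl (p.2 - p.1)) => r; rewrite inE => /eqP->.
  by rewrite translE addrC subrK.
set lt2 := fun p q => _ => /= /andP[/andP[pq1 pq2] qs]; have [f hf] := IH qs.
have fq : f q.1 = q.2 by apply: hf; rewrite mem_head.
have fp : f p.1 < q.2 by rewrite -fq auto_lt.
have s_gt0 : 0 < (q.2 - p.2) / (q.2 - f p.1) by rewrite divr_gt0 // subr_gt0.
exists (stretch q.2 s_gt0 * f)%g => r; rewrite inE autoM /= /stretch_fun.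
case/orP=> [/eqP->|rqs].
  rewrite leNgt fp /= -[f p.1 - _]opprB mulrN divfK ?gt_eqF ?subr_gt0 //.
  by rewrite opprB addrC subrK.
suff -> : q.2 <= f r.1 by apply: hf.
rewrite hf //; move: rqs; rewrite inE => /orP[/eqP->//|].
have lt2_trans : transitive lt2.
  by move=> ? ? ? /andP[a b] /andP[c d]; rewrite /lt2 (lt_trans a) ?(lt_trans b).
by move: qs; rewrite path_sortedE // => /andP[/allP h _] /h /andP[_ /ltW].
Qed.

(** An automorphism that preserves the interval from 0 to 1 is repeated on all
    intervals between consecutive integers, in order to commute with the
    translation by 1. *)
Section PeriodicExtension.

Let fl (x : rat) : rat := (Num.floor x)%:~R.

Definition periodic_fun (f : rat -> rat) x := fl x + f (x - fl x).

Let floorP x : 0 <= x - fl x < 1.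
Proof. by have := floor_itv x; rewrite intrD /fl; lra. Qed.

Let flD x y : 0 <= y < 1 -> fl (fl x + y) = fl x.
Proof.
move=> y01; rewrite /fl; congr (_%:~R); apply: floor_def; rewrite intrD.
by move: y01; rewrite -/(fl x); lra.
Qed.

Variable f : rat_auto.
Hypotheses (f0 : f 0 = 0) (f1 : f 1 = 1).

Let f01 x : 0 <= x < 1 -> 0 <= f x < 1.
Proof. by rewrite -(auto_le f) -(auto_lt f x) f0 f1. Qed.

Let fV01 x : 0 <= x < 1 -> 0 <= (f^-1)%g x < 1.
Proof. by move=> x01; rewrite -(auto_le f) -(auto_lt f _ 1) autoVK f0 f1. Qed.

Let periodicK : cancel (periodic_fun f) (periodic_fun (f^-1)%g).
Proof.
move=> x; rewrite /periodic_fun flD ?f01 // addrAC subrr add0r autoK.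
by rewrite addrC subrK.
Qed.

Let periodicVK : cancel (periodic_fun (f^-1)%g) (periodic_fun f).
Proof.
move=> x; rewrite /periodic_fun flD ?fV01 // addrAC subrr add0r autoVK.
by rewrite addrC subrK.
Qed.

Let periodic_homo : {homo periodic_fun f : x y / x < y}.
Proof.
move=> x y xy; rewrite /periodic_fun.
have : (Num.floor x <= Num.floor y)%R by apply/le_floor/ltW.
rewrite le_eqVlt => /orP[/eqP e|lt_xy].
  by rewrite /fl e ltrD2l auto_lt ltrD2r.
have : fl x + 1 <= fl y by rewrite /fl -[1]/(1%:~R) -intrD ler_int lezD1.
by have := f01 (floorP x); have := f01 (floorP y); lra.
Qed.

Definition periodic_auto := RatAuto periodicK periodicVK periodic_homo.

Lemma periodic_autoE x : 0 <= x < 1 -> periodic_auto x = f x.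
Proof.
move=> x01; rewrite /= /periodic_fun.
have -> : fl x = 0 by have := @flD 0 x x01; rewrite /fl floor0 add0r.
by rewrite subr0 add0r.
Qed.

Lemma periodic_auto_transl1 : (transl 1 ^ periodic_auto)%g = transl 1.
Proof.
apply: rat_auto_ext => x; apply: (@auto_inj periodic_auto); rewrite autoJ !translE /=.
have e : fl (x + 1) = fl x + 1 by rewrite /fl floorDrz // floor1 intrD.
by rewrite /periodic_fun e opprD addrACA subrr addr0 addrAC.
Qed.

End PeriodicExtension.

(** These automorphisms have roots of all orders, and so can serve as images of
    the g_i. *)
Definition conj_transl (t : rat_auto) := exists f c, 0 < c /\ t = (transl c ^ f)%g.

Lemma conj_transl_gt t x : conj_transl t -> x < t x.
Proof.
by case=> f [c [c_gt0 ->]]; rewrite -(auto_lt f) autoJ translE ltrDl.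
Qed.

Lemma conj_translX t e : (0 < e)%N -> conj_transl t -> conj_transl (t ^+ e)%g.
Proof.
move=> e0 [f [c [c_gt0 ->]]]; exists f, (c *+ e); rewrite pmulrn_lgt0 //; split=> //.
by rewrite -conjXg translX.
Qed.

Lemma conj_transl_norm t x : conj_transl t ->
  exists f : rat_auto, t = (transl 1 ^ f)%g /\ f x = 0.
Proof.
case=> f [c [c_gt0 ->]]; have ci : 0 < c^-1 by rewrite invr_gt0.
exists (transl (- (f x / c)) * (scale ci * f))%g; split; last first.
  by rewrite !autoM translE subrr.
rewrite !conjgM; congr (_ ^ _)%g; apply: rat_auto_ext => y.
apply: (@auto_inj (scale ci)); rewrite autoJ.
apply: (@auto_inj (transl (- (f x / c)))); rewrite autoJ !translE /=.
by rewrite mulrDl divff ?gt_eqF // addrAC.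
Qed.

(** In a coordinate where t is the translation by 1 and x is 0, change
    coordinate once more by a map which commutes with t, fixes 0 and sends e, b
    and v to 1/(2r), 2/(2r) and 3/(2r); then y is the translation by 1/r.  The
    last of these values is less than 1 because r is at least 2. *)
Lemma conj_transl_root t r x e b v : conj_transl t -> (1 < r)%N ->
  x < e < b -> b < v < t x ->
  exists y, [/\ conj_transl y, (y ^+ r)%g = t, y x = b & y e = v].
Proof.
move=> ct r1 /andP[xe eb] /andP[bv vt].
have [f [et fx]] := conj_transl_norm x ct; rewrite {}et in vt *.
have ftx : f ((transl 1 ^ f)%g x) = 1 by rewrite autoJ translE fx add0r.
have r_gt0 : 0 < r%:R :> rat by rewrite ltr0n; lia.
set c : rat := (2 * r%:R)^-1; have c_gt0 : 0 < c by rewrite invr_gt0 mulr_gt0.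
have ec : c + c = r%:R^-1 by rewrite /c; field; rewrite gt_eqF.
have c4 : 4 * c <= 1.
  have : (2 : rat) <= r%:R by rewrite ler_nat.
  by rewrite /c ler_pdivrMr ?mulr_gt0 // mul1r; lra.
have e0 : 0 < f e by rewrite -fx auto_lt.
have eb' : f e < f b by rewrite auto_lt.
have bv' : f b < f v by rewrite auto_lt.
have v1 : f v < 1 by rewrite -ftx auto_lt.
have [|h hh] := @auto_interpolation
  [:: (0, 0); (f e, c); (f b, c + c); (f v, c + c + c); (1, 1)].
  rewrite /= e0 eb' bv' v1 /=; apply/and4P; split; lra.
have h0 : h 0 = 0 by apply: (hh (0, 0)); rewrite !inE eqxx ?orbT.
have he : h (f e) = c by apply: (hh (f e, c)); rewrite !inE eqxx ?orbT.
have hb : h (f b) = c + c by apply: (hh (f b, c + c)); rewrite !inE eqxx ?orbT.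
have hv : h (f v) = c + c + c by apply: (hh (f v, c + c + c)); rewrite !inE eqxx ?orbT.
have h1 : h 1 = 1 by apply: (hh (1, 1)); rewrite !inE eqxx ?orbT.
set p := periodic_auto h0 h1.
have pE z : x <= z < (transl 1 ^ f)%g x -> p (f z) = h (f z).
  move=> /andP[z0 z1]; apply: periodic_autoE.
  by rewrite -{1}fx -ftx auto_le auto_lt z0.
exists (transl (c + c) ^ (p * f))%g; split.
- by exists (p * f)%g, (c + c); rewrite addr_gt0.
- rewrite -conjXg translX ec -(mulr_natr r%:R^-1) mulVf ?gt_eqF // conjgM.
  by rewrite periodic_auto_transl1.
- apply: (@auto_inj (p * f)%g); rewrite autoJ !autoM translE !pE ?lexx.
  + by rewrite fx h0 hb add0r.
  + by rewrite (lt_trans bv vt) (ltW (lt_trans xe eb)).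
  + by rewrite /= (lt_trans (lt_trans xe eb) (lt_trans bv vt)).
- apply: (@auto_inj (p * f)%g); rewrite autoJ !autoM translE !pE.
  + by rewrite hv he addrCA addrA.
  + by rewrite vt (ltW (lt_trans (lt_trans xe eb) bv)).
  + by rewrite (ltW xe) (lt_trans (lt_trans eb bv) vt).
Qed.

(** * Actions that move 0 to the right *)
Section Realization.
Variables K L : nat -> nat.
Hypotheses (K_gt1 : forall i, (1 < K i)%N) (L_gt1 : forall i, (1 < L i)%N).

Definition realizes n (f : nat -> rat_auto) :=
  [/\ forall i, (i < n)%N -> (f i ^+ K i = f i.+1 ^+ L i)%g,
      forall i, (i <= n)%N -> conj_transl (f i)
    & forall i, (i <= n)%N -> 0 < twist K f i 0].

Lemma twist_prefix_eq (G : groupType) (f h : nat -> G) i :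
  (forall s, (s < i)%N -> f s = h s) -> twist_prefix K f i = twist_prefix K h i.
Proof. by move=> fh; apply: eq_big_nat => s /andP[_ /fh->]. Qed.

(** This restates that twist n moves 0 to the right.  It leaves room for the
    image of 0 under the next generator, which has to lie between these two
    points for twist n.+1 to move 0 to the right. *)
Lemma twist_prefix_lt n f : realizes n f ->
  ((twist_prefix K f n.+1)^-1)%g 0 < (f n ^+ K n)%g 0.
Proof.
case=> _ _ /(_ n (leqnn n)) pos; rewrite -(auto_lt (twist_prefix K f n.+1)) autoVK.
rewrite twist_prefixS -autoM -mulgA.
have -> // : (f n ^- (K n - 1) * f n ^+ K n)%g = f n.
by rewrite -{2}(subnK (ltnW (K_gt1 n))) expgnDr mulKg.
Qed.

Lemma realizes_extend n f e b v : realizes n f ->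
  0 < e < b -> b < v < (f n ^+ K n)%g 0 -> ((twist_prefix K f n.+1)^-1)%g 0 < b ->
  exists h, [/\ realizes n.+1 h, forall i, (i <= n)%N -> h i = f i,
    h n.+1 0 = b & h n.+1 e = v].
Proof.
move=> [rel trans pos] eb bv wb.
have ct : conj_transl (f n ^+ K n)%g by apply: conj_translX; [apply: ltnW|apply: trans].
have [y [cy yT y0 ye]] := conj_transl_root ct (L_gt1 n) eb bv.
pose h i := if (i <= n)%N then f i else y.
have hf i : (i <= n)%N -> h i = f i by rewrite /h => ->.
have hn : h n.+1 = y by rewrite /h ltnn.
exists h; rewrite hn; split=> //; split=> i.
- rewrite ltnS leq_eqVlt => /orP[/eqP->|lt_in]; first by rewrite hn hf.
  by rewrite !hf ?rel // ltnW.
- by rewrite leq_eqVlt => /orP[/eqP->|le_in]; rewrite ?hn // hf //; apply: trans.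
- have pE : (i <= n.+1)%N -> twist_prefix K h i = twist_prefix K f i.
    by move=> le_in; apply: twist_prefix_eq => s lt_si; apply: hf; lia.
  move=> le_in; rewrite /twist pE //; move: le_in; rewrite leq_eqVlt.
  case/orP=> [/eqP->|le_in]; last by rewrite hf //; apply: pos.
  by rewrite hn autoM y0 -(auto_lt (twist_prefix K f n.+1)^-1%g) autoK.
Qed.

Lemma realizes_exists n : exists f, realizes n f.
Proof.
elim: n => [|n [f rf]].
  exists (fun=> transl 1); split=> // i; last first.
    by rewrite leqn0 => /eqP->; rewrite /twist /twist_prefix big_geq // mul1g translE.
  by exists (1%g : rat_auto), 1; rewrite conjg1.
set w := ((twist_prefix K f n.+1)^-1)%g 0; set t := (f n ^+ K n)%g 0.
have wt : w < t by apply: twist_prefix_lt.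
have t0 : 0 < t.
  by case: rf => _ ct _; apply: conj_transl_gt; apply: conj_translX;
    [apply: ltnW|apply: ct].
have [b [b0 wb bt]] : exists b, [/\ 0 < b, w < b & b < t].
  exists ((Num.max 0 w + t) / 2); case: (lerP 0 w) => ?; split; lra.
have [||h [rh _ _ _]] := @realizes_extend n f (b / 2) b ((b + t) / 2) rf _ _ wb.
- by apply/andP; split; lra.
- by rewrite -/t; apply/andP; split; lra.
by exists h.
Qed.

Lemma conj_transl_ge t e x : conj_transl t -> x <= (t ^+ e)%g x.
Proof.
move=> ct; elim: e => [|e IH] //; rewrite expgS autoM.
by apply: (le_trans IH); apply/ltW/conj_transl_gt.
Qed.

(** The inverse of twist_prefix n is a product of powers of the f i, which move
    all points to the right, and its last factor is the power of f 0. *)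
Lemma twist_prefix_ge n f x : (0 < n)%N -> (forall i, (i < n)%N -> conj_transl (f i)) ->
  (f 0%N ^+ (K 0 - 1))%g x <= ((twist_prefix K f n)^-1)%g x.
Proof.
elim: n => // -[|n] IH _ ct.
  by rewrite twist_prefixS /twist_prefix big_geq // mul1g invgK.
rewrite twist_prefixS invgM invgK autoM.
apply: le_trans (conj_transl_ge _ _ _); last exact: ct.
by apply: IH => // i lt_in; apply: ct; apply: ltnW.
Qed.

(** In the numbering of one level, the first element is the image of the least
    positive element of the previous level, and the second one is the least
    positive element.  Call the first one p, and write the second one as
    q^-1 y with y the last generator.  If they commute, then y maps p 0 to
    (q p q^-1) (y 0), where q p q^-1 does not involve y.  As 0 < p 0 < T 0, the
    root y of T can be chosen with other values at 0 and p 0. *)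
Lemma realizes_noncommuting n : (0 < n)%N -> exists f, realizes n.+1 f /\
  ~ commute (f 0%N ^+ (K 0 - 1) * twist K f n)%g (twist K f n.+1).
Proof.
move=> n_gt0; have [f rf] := realizes_exists n; have [rel ct pos] := rf.
set q := (twist_prefix K f n.+1)^-1%g; set T := (f n ^+ K n)%g.
set p := (f 0%N ^+ (K 0 - 1) * twist K f n)%g.
have wt : q 0 < T 0 by apply: twist_prefix_lt.
have p0 : 0 < p 0.
  apply: (lt_le_trans (pos n _)) => //.
  by rewrite autoM; apply: conj_transl_ge; apply: ct.
have pT : p 0 < T 0.
  (* f n is p times something that moves all points to the right. *)
  apply: (@le_lt_trans _ _ (f n 0)).
    rewrite autoM; apply: le_trans (twist_prefix_ge _ n_gt0 _) _ => [i lt_in|].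
      by apply: ct; apply: ltnW.
    by rewrite -autoM /twist mulKg.
  rewrite /T -[K n](subnK (ltnW (K_gt1 n))) expgnDr autoM.
  by apply: conj_transl_gt; apply: conj_translX; [rewrite subn_gt0|apply: ct].
have [b [pb qb bT]] : exists b, [/\ p 0 < b, q 0 < b & b < T 0].
  by exists ((Num.max (p 0) (q 0) + T 0) / 2); case: (lerP (p 0) (q 0)) => ?; split; lra.
have [v [bv vT vr]] : exists v, [/\ b < v, v < T 0 & v <> (q * p * q^-1)%g b].
  case: (eqVneq ((b + T 0) / 2) ((q * p * q^-1)%g b)) => [<-|/eqP ne].
    by exists ((b + (b + T 0) / 2) / 2); split; [lra|lra|move=> ?; lra].
  by exists ((b + T 0) / 2); split=> //; lra.
have [||h [rh hf h0 hp]] := @realizes_extend n f (p 0) b v rf _ _ qb.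
- by rewrite p0.
- by rewrite bv.
exists h; split=> //.
have pE : twist_prefix K h n.+1 = twist_prefix K f n.+1.
  by apply: twist_prefix_eq => s; apply: hf.
have pE' : twist_prefix K h n = twist_prefix K f n.
  by apply: twist_prefix_eq => s lt_sn; apply: hf; apply: ltnW.
rewrite {1}/twist pE' !hf // -/(twist K f n) -/p /twist pE.
rewrite -[twist_prefix K f n.+1]invgK -/q.
move=> /(congr1 (fun a : rat_auto => a 0)); rewrite !autoM h0 hp => e.
by apply: vr; rewrite !autoM e autoVK.
Qed.

End Realization.

(** * Left orderings and their conjugates *)
Section Orders.
Local Open Scope classical_set_scope.
Local Open Scope group_scope.
Variable G : groupType.

Lemma cone_leftOrder (P : set G) : subsemigroup P -> ~ P 1 ->
  (forall x, x <> 1 -> P x \/ P x^-1) ->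
  exists o : leftOrder G, positive_cone o = P.
Proof.
move=> PM P1 Ptot; pose lt a b := P (a^-1 * b).
have lt_irr a : ~ lt a a by rewrite /lt mulVg.
have lt_trans a b c : lt a b -> lt b c -> lt a c.
  by move=> ab bc; have := PM _ _ ab bc; rewrite -mulgA mulVKg.
have lt_total a b : a <> b -> lt a b \/ lt b a.
  move=> ab; have [e|//|] := Ptot (a^-1 * b); last by rewrite invgM invgK; right.
    by case: ab; rewrite -[b](mulVKg a) e mulg1.
  by left.
have lt_mul g a b : lt a b -> lt (g * a) (g * b).
  by rewrite /lt invgM -mulgA mulKg.
exists (LeftOrder lt_irr lt_trans lt_total lt_mul).
by apply/funext => x; rewrite /positive_cone /= /lt invg1 mul1g.
Qed.

Lemma positive_cone_conj (o : leftOrder G) g x :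
  positive_cone (conj_order o g) x <-> positive_cone o (g^-1 * x * g).
Proof.
rewrite /positive_cone /= mul1g; split=> [/(lo_mul g^-1)|/(lo_mul g)].
  by rewrite mulVg mulgA.
by rewrite mulg1 -mulgA mulVKg.
Qed.

(** The topology is generated by the sets of orderings which make a given
    element positive. *)
Lemma nbhs_leftOrder (o : leftOrder G) U : nbhs o U -> exists s : seq G,
  {in s, forall g, positive_cone o g} /\
  forall o', {in s, forall g, positive_cone o' g} -> U o'.
Proof.
rewrite nbhsE => -[B [[D Dsub <-] [A DA Ao] BU]].
have [E Esub eA] := Dsub _ DA.
pose gen (C : set (leftOrder G)) : G :=
  xget 1 [set g | C = [set o' | lo_lt o' 1 g]].
have genP C : C \in E -> C = [set o' | lo_lt o' 1 (gen C)].
  move=> /Esub; rewrite inE => -[g _ eC].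
  have : exists g, C = [set o' | lo_lt o' 1 g] by exists g.
  exact: (xgetPex 1).
have Ao' : (A : set (leftOrder G)) o := Ao.
exists [seq gen C | C <- enum_fset E]; split=> [_ /mapP[C CE ->]|o' oC].
  by move: Ao'; rewrite -eA => /(_ C CE) /=; rewrite [X in X o]genP.
suff Ao'' : (A : set (leftOrder G)) o' by apply: BU; exists A.
rewrite -eA => C CE; change (C o'); rewrite [C]genP //.
by apply: oC; apply: map_f.
Qed.

(** Conjugation by p is an automorphism of the ordering given by P, so it fixes
    the least positive element q: otherwise p^-1 q p and p q p^-1 are both
    greater than q, and conjugating the second inequality by p gives
    q > p^-1 q p. *)
Lemma min_conj_commute (P : set G) p q : subsemigroup P -> ~ P 1 -> P q ->
  (forall x, P x -> x = q \/ P (q^-1 * x)) ->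
  (forall x, P (p^-1 * x * p) <-> P x) -> commute p q.
Proof.
move=> PM P1 qP qmin pP.
have [e|h1] := qmin (p^-1 * q * p) ((pP q).2 qP).
  by rewrite /commute -[in LHS]e !mulgA mulgV mul1g.
have qP' : P (p * q * p^-1) by apply/pP; rewrite !mulgA mulVg mul1g mulgVK.
have [e|/pP h2] := qmin _ qP'.
  by rewrite /commute -{2}e mulgVK.
case: P1; suff <- : (q^-1 * (p^-1 * q * p)) * (p^-1 * (q^-1 * (p * q * p^-1)) * p) = 1.
  exact: PM.
by rewrite !mulgA !(mulgK, mulgVK) mulVg.
Qed.

End Orders.

(** * The levels of the tower *)
Section Tower.
Local Open Scope group_scope.
Variables k l : int -> nat.
Hypotheses (k_gt1 : forall i, (1 < k i)%N) (l_gt1 : forall i, (1 < l i)%N).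

Section Level.
Variable m : nat.

(** The generators of G_(m) renumbered from 0 to 2m.  The relation between
    numbers s and s + 1 is the one between g_(-m+s) and g_(-m+s+1), whose
    exponents carry the larger of the two indices. *)
Definition level_k (s : nat) : nat := k (- m%:Z + s%:Z + 1)%R.
Definition level_l (s : nat) : nat := l (- m%:Z + s%:Z + 1)%R.
Definition level_gen (s : nat) : tower k l m := tower_gen k l m (- m%:Z + s%:Z)%R.

Let K_gt0 s : (0 < level_k s)%N. Proof. exact/ltnW/k_gt1. Qed.
Let L_gt0 s : (0 < level_l s)%N. Proof. exact/ltnW/l_gt1. Qed.

Local Notation level_twist := (twist level_k level_gen).
Local Notation level_val := (word_val level_k level_gen).

Lemma level_gen_rel s : (s < m.*2)%N ->
  level_gen s ^+ level_k s = level_gen s.+1 ^+ level_l s.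
Proof.
move=> hs; have hi : (- m%:Z + 1 <= - m%:Z + s%:Z + 1 <= m%:Z)%R by lia.
have := @tower_gen_rel k l m _ hi; rewrite addrK /level_gen => ->.
by congr (tower_gen _ _ _ _ ^+ _); lia.
Qed.

Lemma tower_twistE (i : int) : (- m%:Z <= i)%R ->
  tower_twist k l m i = level_twist `|(i + m%:Z)%R|%N.
Proof.
move=> hi; rewrite /tower_twist /twist /level_gen; congr (_ * tower_gen _ _ _ _).
by lia.
Qed.

Definition level_top : tower k l m := level_twist m.*2.

Lemma level_coneP x : tower_cone k l m x <->
  exists i u, [/\ (i <= m.*2)%N, all (leq^~ m.*2) u & x = level_val (i :: u)].
Proof.
split=> [xP|[i [u [le_i hu ->]]]].
  apply: (xP (fun x => exists i u,
    [/\ (i <= m.*2)%N, all (leq^~ m.*2) u & x = level_val (i :: u)])); split.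
    move=> _ _ [i [u [hi hu ->]]] [j [v [hj hv ->]]].
    by exists i, (u ++ j :: v); split; rewrite // ?all_cat ?hu /= ?hj // -word_val_cat.
  move=> _ [->|[i /= hi <-]].
    exists 0%N, [::]; split=> //.
    by rewrite /word_val big_seq1 /twist /twist_prefix big_geq // mul1g /level_gen addr0.
  exists `|(i + m%:Z)%R|%N, [::]; split=> //; first by lia.
  by rewrite /word_val big_seq1 tower_twistE //; lia.
have semi : subsemigroup (tower_cone k l m).
  by move=> y z yP zP A hA; apply: (hA.1); [apply: yP|apply: zP].
have gen j : (j <= m.*2)%N -> tower_cone k l m (level_twist j).
  case: j => [|j] hj; apply: sub_gen_smallest.
    by left; rewrite /twist /twist_prefix big_geq // mul1g /level_gen addr0.
  right; exists (- m%:Z + j.+1%:Z)%R; first by rewrite /=; lia.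
  by rewrite tower_twistE; [congr (level_twist _)|]; lia.
elim: u i le_i hu => [|j u IH] i le_i.
  by rewrite /word_val big_seq1 => _; apply: gen.
move=> /= /andP[le_j hu]; rewrite word_val_cons.
by apply: semi; [apply: gen|apply: IH].
Qed.

Lemma level_index (c : int) : (- m%:Z <= c <= m%:Z)%R ->
  exists2 s : nat, (s <= m.*2)%N & c = (- m%:Z + s%:Z)%R.
Proof. by exists `|(c + m%:Z)%R|%N; lia. Qed.

Lemma level_fraction (x : tower k l m) : fraction level_k m.*2 level_gen x.
Proof.
rewrite [x]presW; elim/last_ind: (repr x) => [|u [i b] IH]; first exact: fraction1.
have [s hs es] := level_index (valP i).
have -> : pres_word (@tower_rel k l m) (rcons u (i, b)) =
    pres_word (@tower_rel k l m) u * (if b then level_gen s else (level_gen s)^-1).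
  have -> : level_gen s = pres_gen (@tower_rel k l m) i.
    by rewrite /level_gen -es tower_genE.
  rewrite -cats1 pres_wordM; congr (_ * _); case: b => //.
  by rewrite -pres_wordV.
rewrite -(word_val_gen level_k level_gen s).
have gs : all (leq^~ m.*2) (gen_word level_k s) by apply: all_gen_word.
case: b; first exact: fractionM.
exact: (fractionV K_gt0 L_gt0 level_gen_rel).
Qed.

Lemma level_total x : x <> 1 -> tower_cone k l m x \/ tower_cone k l m x^-1.
Proof.
have pos y : y <> 1 -> nonneg level_k m.*2 level_gen y -> tower_cone k l m y.
  move=> y1 [[|i u]]; first by rewrite /word_val big_nil.
  by move=> /= /andP[hi hu] ->; apply/level_coneP; exists i, u.
move=> x1; have := fraction_comparable K_gt0 L_gt0 level_gen_rel (level_fraction x).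
case=> h; [left|right]; apply: pos => //.
by move=> e; apply: x1; rewrite -[x]invgK e invg1.
Qed.

Lemma level_top_min x : tower_cone k l m x ->
  x = level_top \/ tower_cone k l m (level_top^-1 * x).
Proof.
move=> /level_coneP[i [u [hi hu ex]]].
have [[|j v] /= hv ev] := nonneg_divl_top K_gt0 L_gt0 level_gen_rel hi hu ex.
  left; rewrite -[x](mulVKg level_top); move: ev; rewrite /word_val big_nil => ->.
  by rewrite mulg1.
by right; rewrite ev; apply/level_coneP; exists j, v; case/andP: hv.
Qed.

(** A family that satisfies the relations extends to the group presented by
    them. *)
Lemma realization_hom (f : nat -> rat_auto) : realizes level_k level_l m.*2 f ->
  exists phi : UMagmaMorphism.type (tower k l m) rat_auto,
    [/\ forall i, (i <= m.*2)%N -> phi (level_gen i) = f i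
      & forall i, (i <= m.*2)%N -> phi (level_twist i) = twist level_k f i].
Proof.
case=> rel _ _; pose h (i : tower_idx m) := f `|(val i + m%:Z)%R|%N.
have hR u v : @tower_rel k l m u v -> word_eval h u = word_eval h v.
  case=> i j ij; rewrite /word_eval !big_nseq /= !iter_mulg_1.
  have [s hs es] := level_index (valP i); have [t ht et] := level_index (valP j).
  rewrite /h ij es.
  have -> : `|(- m%:Z + s%:Z + m%:Z)%R|%N = s by lia.
  have -> : `|(- m%:Z + s%:Z + 1 + m%:Z)%R|%N = s.+1 by lia.
  by rewrite (ij : sval j = _) es; apply: rel; move: ij; rewrite es et; lia.
pose phi0 : tower k l m -> rat_auto := pres_lift h.
pose phi : UMagmaMorphism.type (tower k l m) rat_auto := HB.pack phi0
  (isUMagmaMorphism.Build _ _ phi0 (pres_lift_monoid_morphism hR)).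
have phi_gen i : (i <= m.*2)%N -> phi (level_gen i) = f i.
  move=> hi; have [|x ex] := @tower_idxP m (- m%:Z + i%:Z)%R; first by lia.
  rewrite /level_gen -ex tower_genE; apply: etrans (pres_lift_gen hR x) _.
  by rewrite /h ex; congr f; lia.
exists phi; split=> // i hi.
rewrite /twist gmulfM phi_gen //; congr (_ * _); rewrite /twist_prefix gmulf_prod.
by apply: eq_big_nat => s hs; rewrite gmulfXVn phi_gen //; lia.
Qed.

Lemma level_cone1 : ~ tower_cone k l m 1.
Proof.
have [f rf] : exists f, realizes level_k level_l m.*2 f.
  by apply: realizes_exists => s; [apply: k_gt1|apply: l_gt1].
have [phi [_ phia]] := realization_hom rf; have [_ _ pos] := rf.
have main i u : (i <= m.*2)%N -> all (leq^~ m.*2) u ->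
    (0 < (phi (level_val (i :: u)) : rat_auto) 0)%R.
  elim: u i => [|j u IH] i hi.
    by move=> _; rewrite /word_val big_seq1 phia // pos.
  move=> /= /andP[hj hu]; rewrite word_val_cons gmulfM autoM phia //.
  by apply: lt_trans (pos i hi) _; rewrite auto_lt IH.
move=> /level_coneP[i [u [hi hu e]]]; have := main i u hi hu.
by rewrite -e gmulf1 ltxx.
Qed.

End Level.

(** * The inductive limit *)
Lemma level_coneM m : subsemigroup (tower_cone k l m).
Proof. by move=> x y xP yP A hA; apply: (hA.1); [apply: xP|apply: yP]. Qed.

Local Notation tower_maps :=
  (fun m => @tower_map k l m : UMagmaMorphism.type (tower k l m) (tower k l m.+1)).
Local Notation emb := (Defs.lim_in tower_maps).

(** The transition maps preserve positivity, hence negativity; by trichotomy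
    they also reflect it. *)
Lemma tower_cone_mapE m (x : tower k l m) :
  tower_cone k l m.+1 (tower_map x) <-> tower_cone k l m x.
Proof.
split=> [fx|]; last exact: tower_cone_map.
have [x1|/eqP/level_total[//|xV]] := eqVneq x 1.
  by case: (@level_cone1 m.+1); move: fx; rewrite x1 gmulf1.
case: (@level_cone1 m.+1); rewrite -[1](mulgV (tower_map x)).
by apply: level_coneM fx _; rewrite -gmulfV; apply: tower_cone_map.
Qed.

Lemma lim_cone_in m (x : tower k l m) :
  tower_lim_cone k l (emb x) <-> tower_cone k l m x.
Proof.
pose C (u : {m : nat & tower k l m}) := tower_cone k l (tag u) (tagged u).
have Citer n u : C (iter n (lim_step tower_maps) u) <-> C u.
  by elim: n => //= n <-; apply: tower_cone_mapE.
split=> [[n _ [y yC]]|xC]; last by exists m => //; exists x.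
case/lim_classP=> a [b e].
by have := (Citer a (Tagged (fun m => tower k l m : Type) y)).2 yC; rewrite e => /Citer.
Qed.

Lemma lim_coneM : subsemigroup (tower_lim_cone k l).
Proof.
move=> x y; have [m [x' [y' [-> ->]]]] := lim_in2P x y.
by rewrite -lim_inM !lim_cone_in; apply: level_coneM.
Qed.

Lemma lim_cone1 : ~ tower_lim_cone k l 1.
Proof. by rewrite -[1]/(emb (1 : tower k l 0)) lim_cone_in; apply: level_cone1. Qed.

Lemma lim_cone_total x :
  x <> 1 -> tower_lim_cone k l x \/ tower_lim_cone k l x^-1.
Proof.
have [m [y ->]] := lim_inP x => y1; rewrite -gmulfV !lim_cone_in.
by apply: level_total => e; apply: y1; rewrite e gmulf1.
Qed.

Lemma emb_raise m n (x : tower k l m) :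
  (m <= n)%N -> exists y : tower k l n, emb x = emb y.
Proof. by move/subnK <-; apply: lim_in_iter. Qed.

(** The level is taken positive, so that the last generator of the cone has an
    index to which [tower_map_twist] applies. *)
Lemma common_level (s : seq (tower_lim k l)) :
  exists m, {in s, forall g, exists x : tower k l m.+1, g = emb x}.
Proof.
elim: s => [|g s [m hm]]; first by exists 0%N.
have [n [y ->]] := lim_inP g; exists (m + n)%N => x; rewrite inE.
by case/orP=> [/eqP->|/hm[z ->]]; apply: emb_raise; lia.
Qed.

Lemma level_top_noncommuting m :
  ~ commute (tower_map (level_top m.+1)) (level_top m.+2).
Proof.
set n := m.+1.*2.+1; have en : n.+1 = m.+2.*2 by rewrite /n; lia.
have [||//|f [rf ncomm]] := @realizes_noncommuting (level_k m.+2) (level_l m.+2) _ _ n.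
- by move=> i; apply: k_gt1.
- by move=> i; apply: l_gt1.
rewrite en in rf; have [phi [phi_gen phi_twist]] := realization_hom rf.
have -> : tower_map (level_top m.+1) = level_gen m.+2 0 ^+ (level_k m.+2 0 - 1)
    * twist (level_k m.+2) (level_gen m.+2) n.
  have -> : level_top m.+1 = tower_twist k l m.+1 m.+1%:Z.
    rewrite tower_twistE; last by lia.
    by rewrite /level_top; congr twist; lia.
  rewrite tower_map_twist; last by lia.
  rewrite tower_twistE; last by lia.
  rewrite /level_gen /level_k; congr (tower_gen _ _ _ _ ^+ (k _ - 1) * twist _ _ _).
    by lia.
  by lia.
have := phi_twist n; have := phi_twist n.+1; rewrite en => /(_ (leqnn _)) pB.
move=> /(_ ltac:(lia)) pA comm; apply: ncomm; move: pA pB comm.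
rewrite /level_top en /commute; move: (twist _ _ n) (twist _ _ _.*2) => A B pA pB.
by move=> /(congr1 phi); rewrite !gmulfM gmulfXn pA pB phi_gen.
Qed.

(** The conjugating element is the least positive element of a level which
    contains the elements that define the neighbourhood. *)
Lemma lim_approximated (o : leftOrder (tower_lim k l)) :
  positive_cone o = tower_lim_cone k l -> approximated_by_conjugates o.
Proof.
move=> oP U /nbhs_leftOrder[s [so sU]]; rewrite oP in so.
have [m hm] := common_level s.
set p := level_top m.+1; exists (emb p).
have pC : tower_cone k l m.+1 p.
  apply/level_coneP; exists m.+1.*2, [::].
  by rewrite leqnn /word_val big_seq1.
have conjP n (x y : tower k l n) :
  positive_cone (conj_order o (emb y)) (emb x) <-> tower_cone k l n (y^-1 * x * y).
  by rewrite positive_cone_conj oP -gmulfV -!gmulfM; apply: lim_cone_in.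
split.
  apply: sU => g gs; have [x eg] := hm g gs.
  have xC : tower_cone k l m.+1 x by have := so g gs; rewrite eg => /lim_cone_in.
  rewrite eg; apply/conjP.
  have [->|h] := level_top_min xC; first by rewrite mulVg mul1g.
  exact: level_coneM.
move=> e; apply: (@level_top_noncommuting m); rewrite -/p.
apply: (@min_conj_commute _ (tower_cone k l m.+2)).
- exact: level_coneM.
- exact: level_cone1.
- apply/level_coneP; exists m.+2.*2, [::].
  by rewrite leqnn /word_val big_seq1.
- by move=> x; apply: level_top_min.
move=> x; rewrite -conjP lim_in_step e oP.
exact: lim_cone_in.
Qed.

End Tower.

Theorem theorem1p1 (k l : int -> nat)
    (k_gt1 : forall n : int, (1 < k n)%N)
    (l_gt1 : forall n : int, (1 < l n)%N)
    (co_kl : forall n : int, coprime (k n) (l n)) :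
  (exists o : leftOrder (tower_lim k l),
     positive_cone o = tower_lim_cone k l /\ approximated_by_conjugates o)
  /\ ~ (exists o : leftOrder (tower_lim k l),
          positive_cone o = tower_lim_cone k l /\ isolated_order o).
Proof.
have [o oP] := cone_leftOrder (@lim_coneM k l k_gt1 l_gt1)
  (@lim_cone1 k l k_gt1 l_gt1) (@lim_cone_total k l k_gt1 l_gt1).
have approx : approximated_by_conjugates o by apply: lim_approximated.
split; first by exists o.
case=> o' [o'P [_ [V Vo' VT]]]; have eo : o' = o by apply: leftOrder_ext; rewrite oP.
rewrite {o' o'P}eo in Vo' VT; have [g [Vg ne]] := approx V Vo'.
by apply: ne; move: VT; rewrite setIT => VT; move: Vg; rewrite VT.
Qed.
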